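(* For every $n \in \mathbb{N}$ there exists a probabilistic online monotone embedding (which may depend on $n$) of update sequences of length at most $n$, with points from an arbitrary metric space $(X,d_X)$, into HSTs with distortion $O(\log^2 n)$. If the points come from a $D$-dimensional normed space $(\mathbb{R}^D,\|\cdot\|)$ with $D=O(1)$, the distortion improves to $O(\log n)$.
   Context: For $\mu \ge 1$, a $\mu$-HST (hierarchically well-separated tree) is a metric space whose points are the leaves of a rooted tree $T$; every node $v$ has a weight $\varphi(v)\ge 0$, with $\varphi(v)=0$ iff $v$ is a leaf, and $\varphi(v)\le \varphi(u)/\mu$ whenever $v$ is a child of $u$; the distance between leaves $u,v$ is $d_T(u,v)=\varphi(\mathrm{lca}(u,v))$. ''HSTs'' denotes the family of such metrics. An update sequence on $(X,d_X)$ is a sequence of pairs $(v_t,o_t)\in X\times\{+,-\}$, $t=1,\dots,n$: $v_t$ arrives if $o_t=+$ and leaves if $o_t=-$. The alive sets are $L_0=\varnothing$, $L_t=L_{t-1}\cup\{v_t\}$ if $o_t=+$ and $L_t=L_{t-1}\setminus\{v_t\}$ if $o_t=-$. A deterministic online monotone embedding into a family $\mathcal M$ receives $\sigma_1,\sigma_2,\dots$ one at a time and after receiving $\sigma_t$ (and depending only on $\sigma_1,\dots,\sigma_t$) outputs a metric $d_t$ on $L_t$ such that: (1) $(L_t,d_t)\in\mathcal M$; (2) $d_t(u,v)\ge d_X(u,v)$ for all $u,v\in L_t$; (3) $d_t(u,v)\le d_{t-1}(u,v)$ for all $u,v\in L_{t-1}\cap L_t$. A probabilistic online monotone embedding is a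 probability distribution over deterministic ones (the update sequence is fixed independently of the random choices); it has distortion $\lambda$ if for every update sequence $\sigma$ (of the considered class), every $t$ and all $u,v\in L_t$, $\mathbb{E}[d_t(u,v)]\le\lambda\, d_X(u,v)$. *)

(* Defs.v *)
From HB Require Import structures.
From mathcomp Require Import all_boot all_order all_algebra.
From mathcomp Require Import all_classical all_reals.
From mathcomp Require Import topology normedtype sequences exp measure
  lebesgue_measure lebesgue_integral probability.

Set Implicit Arguments.
Unset Strict Implicit.
Unset Printing Implicit Defensive.

Import Order.TTheory GRing.Theory Num.Theory.
Local Open Scope classical_set_scope.
Local Open Scope ring_scope.

Definition is_metric (R : realType) (X : Type) (d : X -> X -> R) : Prop :=
  (forall x y, 0 <= d x y) /\
  (forall x y, d x y = 0 <-> x = y) /\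
  (forall x y, d x y = d y x) /\
  (forall x y z, d x z <= d x y + d y z).

Definition is_norm (R : realType) (D : nat) (N : 'rV[R]_D -> R) : Prop :=
  (forall x, 0 <= N x) /\
  (forall x, N x = 0 -> x = 0) /\
  (forall (a : R) x, N (a *: x) = `|a| * N x) /\
  (forall x y, N (x + y) <= N x + N y).

(* an update is a pair (v, o); o = true means '+' (arrival), false means '-' *)
Definition update (X : Type) := (X * bool)%type.

Definition alive (X : Type) (s : seq (update X)) : set X :=
  foldl (fun L (p : update X) => if p.2 then L `|` [set p.1] else L `\` [set p.1])
        set0 s.

Section HST.
Variables (R : realType) (V : finType) (par : V -> V) (root : V).

Definition child (v u : V) : Prop := v != root /\ par v = u.
Definition is_leaf (v : V) : Prop := forall w, ~ child w v.
Definition ancestor (u v : V) : Prop := exists k, iter k par v = u.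
Definition is_lca (a b w : V) : Prop :=
  ancestor w a /\ ancestor w b /\
  (forall w', ancestor w' a -> ancestor w' b -> ancestor w' w).

Definition is_HST_tree (phi : V -> R) (mu : R) : Prop :=
  par root = root /\
  (forall v, exists k, iter k par v = root) /\
  (forall v, 0 <= phi v) /\
  (forall v, phi v = 0 <-> is_leaf v) /\
  (forall u v, child v u -> phi v <= phi u / mu).
End HST.

(* (S, d) is (isometric to) a mu-HST for some mu >= 1.  The empty metric space
   is counted as a member of the family (degenerate case). *)
Definition HST_metric (R : realType) (X : Type) (S : set X) (d : X -> X -> R)
  : Prop :=
  S = set0 \/
  exists (mu : R) (V : finType) (par : V -> V) (root : V) (phi : V -> R)
         (lf : X -> V),
    1 <= mu /\ is_HST_tree par root phi mu /\
    (forall a b, S a -> S b -> lf a = lf b -> a = b) /\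
    (forall v, is_leaf par root v <-> exists x, S x /\ lf x = v) /\
    (forall a b, S a -> S b ->
       exists w, is_lca par (lf a) (lf b) w /\ d a b = phi w).

(* A deterministic online embedding is a map from the prefix received so far
   to the output metric d_t (only its values on the alive set matter);
   it thus depends only on sigma_1..sigma_t.  Conditions are imposed on all
   update sequences of length at most n. *)
Definition det_online_monotone_emb_HST (R : realType) (X : Type)
  (dX : X -> X -> R) (n : nat) (e : seq (update X) -> X -> X -> R) : Prop :=
  forall s : seq (update X), (size s <= n)%N ->
    HST_metric (alive s) (e s) /\
    (forall u v, alive s u -> alive s v -> dX u v <= e s u v) /\
    (forall s' x, s = rcons s' x ->
       forall u v, alive s' u -> alive s u -> alive s' v -> alive s v ->
         e s u v <= e s' u v).

Definition prob_online_monotone_emb_HST (R : realType) (X : Type)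
  (dX : X -> X -> R) (n : nat) (lam : R) : Prop :=
  exists (dd : measure_display) (Omega : measurableType dd)
         (P : probability Omega R)
         (e : Omega -> seq (update X) -> X -> X -> R),
    (forall w, det_online_monotone_emb_HST dX n (e w)) /\
    (forall s, (size s <= n)%N -> forall u v,
        measurable_fun setT (fun w => e w s u v)) /\
    (forall s, (size s <= n)%N -> forall u v, alive s u -> alive s v ->
        (\int[P]_w (e w s u v)%:E <= (lam * dX u v)%:E)%E).

(* Main.v *)
Require Import Defs.
From HB Require Import structures.
From mathcomp Require Import all_boot all_order all_algebra.
From mathcomp Require Import all_classical all_reals.
From mathcomp Require Import topology normedtype sequences exp measure
  lebesgue_measure lebesgue_integral probability.
From mathcomp Require Import numfun measurable_realfun.
From mathcomp Require Import zify lra ring.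
Set Implicit Arguments.
Unset Strict Implicit.
Unset Printing Implicit Defensive.
Import Order.TTheory GRing.Theory Num.Theory.
Local Open Scope ring_scope.

(** A 1-HST is the same thing as a finite ultrametric.  At every scale [2 ^ i]
    the points seen so far are partitioned by carving balls, in order of
    arrival, around the points of a greedy net; the ball radii are random
    multiples of the scale, and the same multiples serve all scales, because
    the expectation is only ever summed over scales.  The output distance of
    [u] and [v] is [10 * 2 ^ i] for the largest scale separating them.  At a
    fixed scale [u] and [v] are separated with probability
    [O(log n) * d u v / 2 ^ i] if the radii are exponential, and with
    probability [O(d u v / 2 ^ i)] if they are uniform and, as in a normed
    space of bounded dimension, only boundedly many net points are near [u]
    and [v].

    It remains to restrict attention to the [O(log n)] scales below
    [n ^ 6 * d u v].  Here monotonicity is used: the first ball (the hub) whose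
    boundary cuts a pair [n ^ 6] times closer than the scale makes all clusters
    around it merge, which only decreases distances.  Domination leaves
    room for a single hub per scale, but cutting a close pair afterwards takes
    a second, independent ball that also cuts a close pair, and the
    contribution of this event is geometrically summable over all scales. *)

(** * Finite ultrametrics are HSTs *)

Section UltrametricTree.
Variables (R : realType) (m : nat) (D : 'I_m.+1 -> 'I_m.+1 -> R).
Hypothesis D_ge0 : forall i j, 0 <= D i j.
Hypothesis D_eq0 : forall i j, D i j = 0 <-> i = j.
Hypothesis D_sym : forall i j, D i j = D j i.
Hypothesis D_ultra : forall i j k, D i k <= Num.max (D i j) (D j k).

(** The levels of the tree are the distance values that occur, with 0 for the leaves. Reading them
    through [minn l L] makes [v] constant from the top level on, so that the root can be its own
    parent. *)
Let vals : seq R :=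
  sort <=%R (undup (0 :: [seq D p.1 p.2 | p : 'I_m.+1 * 'I_m.+1])).
Let L := (size vals).-1.
Let v l := nth 0 vals (minn l L).

Let size_vals : size vals = L.+1.
Proof.
rewrite prednK // -has_predT; apply/hasP; exists 0 => //.
by rewrite mem_sort mem_undup mem_head.
Qed.

Let vals_sorted : sorted <%R vals.
Proof. by rewrite lt_sorted_uniq_le sort_uniq undup_uniq sort_le_sorted. Qed.

Let v_mono k l : (k <= l)%N -> v k <= v l.
Proof.
move=> kl; rewrite /v lt_sorted_leq_nth ?inE ?size_vals //; first by lia.
- by rewrite ltnS geq_minr.
- by rewrite ltnS geq_minr.
Qed.

Let v_lt k l : (l <= L)%N -> (k < l)%N -> v k < v l.
Proof. by move=> lL kl; rewrite /v lt_sorted_ltn_nth ?inE ?size_vals //; lia. Qed.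

Let v_ge0 l : 0 <= v l.
Proof.
have : v l \in vals by rewrite mem_nth // size_vals ltnS geq_minr.
rewrite mem_sort mem_undup inE => /orP[/eqP -> // | /mapP[p _ ->]].
exact: D_ge0.
Qed.

Let lev i j := index (D i j) vals.

Let lev_le i j : (lev i j <= L)%N.
Proof.
rewrite -ltnS -size_vals index_mem mem_sort mem_undup inE; apply/orP; right.
by apply/mapP; exists (i, j); rewrite ?mem_enum.
Qed.

Let v_lev i j : v (lev i j) = D i j.
Proof.
rewrite /v (minn_idPl (lev_le i j)) nth_index //.
by rewrite -index_mem size_vals ltnS lev_le.
Qed.

Let v0 : v 0 = 0.
Proof.
apply/eqP; rewrite eq_le v_ge0 andbT.
have D00 : D ord0 ord0 = 0 by apply/D_eq0.
by rewrite -[leRHS]D00 -v_lev; apply: v_mono.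
Qed.

Let lev_min i j l : D i j <= v l -> (lev i j <= l)%N.
Proof.
rewrite -v_lev leNgt; case: (leqP (lev i j) l) => // ll.
by rewrite v_lt // lev_le.
Qed.

Let D_top i j : D i j <= v L.
Proof. by rewrite -v_lev; apply: v_mono; apply: lev_le. Qed.

(** Closed balls of a fixed radius in an ultrametric are equivalence classes. As [pick] depends only
    on the extension of its predicate, it selects the same point for all members of a ball. *)
Let rep l i : 'I_m.+1 := odflt i [pick k | D i k <= v l].

Let rep_in l i : D i (rep l i) <= v l.
Proof.
rewrite /rep; case: pickP => [k //|] /(_ i).
by rewrite (D_eq0 i i).2 // v_ge0.
Qed.

Let rep_eq l i j : D i j <= v l -> rep l i = rep l j.
Proof.
move=> ij; have E : (fun k => D i k <= v l) =1 (fun k => D j k <= v l).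
  move=> k; apply/idP/idP => h.
    by apply: le_trans (D_ultra j i k) _; rewrite ge_max h D_sym ij.
  by apply: le_trans (D_ultra i j k) _; rewrite ge_max h ij.
rewrite /rep (eq_pick E); case: pickP => //= /(_ j).
by rewrite (D_eq0 j j).2 // v_ge0.
Qed.

Let rep_inj l i j : rep l i = rep l j -> D i j <= v l.
Proof.
move=> E; apply: le_trans (D_ultra i (rep l i) j) _.
by rewrite ge_max rep_in E D_sym rep_in.
Qed.

(** A ball is stored as its level and its canonical representative, which gives a finite type of
    nodes without quotients. One ball may occur at several levels, as a chain of nodes. *)
Let node_pred (p : 'I_L.+1 * 'I_m.+1) := rep p.1 p.2 == p.2.
Let V := {p : 'I_L.+1 * 'I_m.+1 | node_pred p}.

Let node_proof l (i : 'I_m.+1) :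
  node_pred ((inord (minn l L) : 'I_L.+1), rep (inord (minn l L) : 'I_L.+1) i).
Proof. by apply/eqP/esym/rep_eq/rep_in. Qed.

Let node l i : V := exist (fun p => is_true (node_pred p)) _ (node_proof l i).

Let v_min l : v (minn l L) = v l.
Proof. by rewrite /v -minnA minnn. Qed.

Let node_lev l i : (val (node l i)).1 = minn l L :> nat.
Proof. by rewrite /= inordK // ltnS geq_minr. Qed.

Let node_eq l i k j : minn l L = minn k L -> D i j <= v l -> node l i = node k j.
Proof.
move=> E ij; apply: val_inj; rewrite /= -E; congr pair.
by apply: rep_eq; rewrite inordK ?ltnS ?geq_minr // v_min.
Qed.

Let node_inj l i k j : node l i = node k j ->
  minn l L = minn k L /\ D i j <= v l.
Proof.
move=> E; have E1 : minn l L = minn k L by rewrite -(node_lev l i) E node_lev.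
split => //; have := congr1 (fun x => (val x).2) E; rewrite /= -E1.
by move/rep_inj; rewrite inordK ?ltnS ?geq_minr // v_min.
Qed.

Let nodeE (p : V) : exists l i, (l <= L)%N /\ p = node l i.
Proof.
case: p => [[l i] /= hp]; exists l, i; have lL : (l <= L)%N by rewrite -ltnS.
split => //; apply: val_inj; rewrite /= (minn_idPl lL) inord_val.
by move/eqP: hp => /= ->.
Qed.

Let par (p : V) : V := node (val p).1.+1 (val p).2.
Let root : V := node L ord0.
Let phi (p : V) : R := v (val p).1.

Let par_node l i : par (node l i) = node l.+1 i.
Proof.
rewrite /par; apply: node_eq; first by rewrite node_lev; lia.
rewrite node_lev D_sym /=; apply: le_trans (rep_in _ _) _.
by rewrite inordK ?ltnS ?geq_minr //; apply: v_mono.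
Qed.

Let iter_par k l i : iter k par (node l i) = node (l + k) i.
Proof. by elim: k => [|k IH]; rewrite ?addn0 // iterS IH par_node addnS. Qed.

Let node_root l i : (L <= l)%N -> node l i = root.
Proof.
move=> Ll; apply: node_eq; first by rewrite minnn (minn_idPr Ll).
by apply: le_trans (D_top _ _) (v_mono Ll).
Qed.

Let phi_node l i : phi (node l i) = v l.
Proof. by rewrite /phi node_lev v_min. Qed.

Let node_leaf l i : (l <= L)%N -> is_leaf par root (node l i) <-> l = 0%N.
Proof.
move=> lL; split => [lf | -> w].
  case: l lL lf => // l lL /(_ (node l i)) []; split; last exact: par_node.
  by apply/eqP => /node_inj []; lia.
case: (nodeE w) => k [j [kL ->]] [/eqP wr]; rewrite par_node => /node_inj [E _].
by case: wr; apply: node_root; lia.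
Qed.

(** Leaves are the balls of radius 0, and the least common ancestor of [i] and [j] is the ball
    around them at the level of [D i j]. Weights are merely monotone along the tree, hence [mu] is
    1. *)
Lemma ultrametric_tree : exists (V : finType) (par : V -> V) (root : V)
    (phi : V -> R) (lf : 'I_m.+1 -> V),
  [/\ is_HST_tree par root phi 1, injective lf,
      forall v, is_leaf par root v <-> exists i, lf i = v
    & forall i j, exists w, is_lca par (lf i) (lf j) w /\ D i j = phi w].
Proof.
exists V, par, root, phi, (node 0); split.
- split; first by rewrite /root par_node node_root.
  split.
    move=> w; case: (nodeE w) => l [i [lL ->]]; exists L.
    by rewrite iter_par node_root // leq_addl.
  split; first by move=> w; apply: v_ge0.
  split.
    move=> w; case: (nodeE w) => l [i [lL ->]]; rewrite phi_node node_leaf //.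
    split=> [|-> //]; case: l lL => // l lL vl.
    by have := v_lt lL (ltn0Sn l); rewrite vl v0 ltxx.
  move=> u w [wr <-]; rewrite divr1.
  by case: (nodeE w) => l [i [lL ->]]; rewrite par_node !phi_node; apply: v_mono.
- by move=> i j /node_inj [_]; rewrite v0 => h; apply/D_eq0/le_anti; rewrite h D_ge0.
- move=> w; case: (nodeE w) => l [i [lL ->]]; rewrite node_leaf //; split.
    by move=> ->; exists i.
  by case=> j /node_inj [E _]; lia.
- move=> i j; exists (node (lev i j) i); split; last by rewrite phi_node v_lev.
  split; first by exists (lev i j); rewrite iter_par.
  split.
    exists (lev i j); rewrite iter_par; apply: node_eq => //.
    by rewrite add0n v_lev D_sym.
  move=> w [k <-] [k']; rewrite !iter_par !add0n => /node_inj [E ji].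
  (* A common ancestor is a ball containing both points, so its level is at least that of [D i j],
     and climbing the difference of the levels from the candidate reaches it. *)
  have kl : (lev i j <= k')%N by apply: lev_min; rewrite D_sym.
  exists (k - lev i j)%N; rewrite iter_par.
  apply: node_eq; last by rewrite (D_eq0 i i).2 // v_ge0.
  have := lev_le i j; lia.
Qed.

End UltrametricTree.

Lemma finite_ultrametric_HST (R : realType) (X : choiceType) (xs : seq X)
    (S : set X) (d : X -> X -> R) :
  (forall x, S x -> x \in xs) ->
  (forall x y, S x -> S y -> 0 <= d x y) ->
  (forall x y, S x -> S y -> d x y = 0 <-> x = y) ->
  (forall x y, S x -> S y -> d x y = d y x) ->
  (forall x y z, S x -> S y -> S z -> d x z <= Num.max (d x y) (d y z)) ->
  HST_metric S d.
Proof.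
move=> Sxs d_ge0 d_eq0 d_sym d_ultra.
pose ps := undup [seq x <- xs | `[< S x >]].
have psP x : x \in ps <-> S x.
  rewrite mem_undup mem_filter; split; first by case/andP => /asboolP.
  by move=> Sx; rewrite Sxs // andbT; apply/asboolP.
case: (pselect (S = set0)) => [|/eqP/set0P[x0 Sx0]]; [by left | right].
pose m := (size ps).-1.
have sz : size ps = m.+1.
  by rewrite prednK // -has_predT; apply/hasP; exists x0 => //; apply/psP.
pose p (i : 'I_m.+1) := nth x0 ps i.
have Sp i : S (p i) by apply/psP; rewrite mem_nth // sz.
pose r x : 'I_m.+1 := inord (index x ps).
have pr x : S x -> p (r x) = x.
  by move/psP => xps; rewrite /p inordK ?nth_index // -sz index_mem.
have rp i : r (p i) = i.
  by rewrite /r /p index_uniq ?sz ?undup_uniq // inord_val.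
have p_inj : injective p by apply: (can_inj rp).
have [V [par [root [phi [lf [T lf_inj leaves lca]]]]]] :=
  @ultrametric_tree R m (fun i j => d (p i) (p j))
    (fun i j => d_ge0 _ _ (Sp i) (Sp j))
    (fun i j => iff_trans (d_eq0 _ _ (Sp i) (Sp j))
       (conj (@p_inj i j) (congr1 p (y := j))))
    (fun i j => d_sym _ _ (Sp i) (Sp j))
    (fun i j k => d_ultra _ _ _ (Sp i) (Sp j) (Sp k)).
exists 1, V, par, root, phi, (lf \o r); do 2!split => //.
split; first by move=> a b Sa Sb /lf_inj E; rewrite -(pr a) // E pr.
split.
  move=> w; split; first by move/leaves => [i <-]; exists (p i); rewrite /= rp.
  by move=> [x [Sx <-]]; apply/leaves; exists (r x).
by move=> a b Sa Sb; have := lca (r a) (r b); rewrite !pr.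
Qed.

(** * One scale *)

Section Level.
Variables (R : realType) (d : nat -> nat -> R) (delta N : R) (c : nat -> nat -> bool).

(** Points are indices in order of arrival, and [c j y] is the event that the ball of [j] contains
    [y], so this section is deterministic. The separation [delta / 4] is the radius that every ball
    is sure to have. *)
Fixpoint net (m : nat) : seq nat :=
  if m is m'.+1 then
    if all (fun k => delta / 4 < d k m') (net m') then rcons (net m') m' else net m'
  else [::].

(** The recursion runs over candidate centres rather than over points, so an assignment once made is
    final. *)
Fixpoint owner (m y : nat) : option nat :=
  if m is m'.+1 then
    if owner m' y is Some j then Some j
    else if (m' \in net m'.+1) && c m' y then Some m' else None
  else None.

(** A rare position when [N] is a large power of the number of points. It is defined for all
    centres, in the net or not, and persists as further points arrive. *)
Definition bad (m j : nat) : bool :=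
  [exists l : 'I_m, exists l' : 'I_m, (N * d l l' <= delta) && (c j l != c j l')].

(* The hub is never replaced, so that no merge is ever undone. *)
Fixpoint hub (m : nat) : option nat :=
  if m is m'.+1 then
    if hub m' is Some j then Some j
    else omap val [pick j : 'I_m'.+1 | bad m'.+1 j]
  else None.

(* [m] is a junk value: every point seen so far has an owner. *)
Definition label (m y : nat) : nat :=
  if owner m y is Some j then
    if hub m is Some k then if d k j <= 2 * delta then k else j else j
  else m.

Definition parted (m y z : nat) : bool := label m y != label m z.

Lemma net_rec (P : nat -> Prop) m : (forall k, (k < m)%N -> P k) -> 
  forall k, k \in net m -> P k.
Proof.
elim: m => //= m IH h k; case: ifP => _; last by apply: IH => ? ?; apply: h; lia.
rewrite mem_rcons inE => /orP[/eqP ->|]; first exact: h.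
by apply: IH => ? ?; apply: h; lia.
Qed.

Lemma net_lt m k : k \in net m -> (k < m)%N.
Proof. exact: (net_rec (P := fun k => (k < m)%N)). Qed.

Lemma net_self m : (m \in net m.+1) = all (fun k => delta / 4 < d k m) (net m).
Proof.
rewrite /=; case: ifP => _; first by rewrite mem_rcons mem_head.
by apply/negP => /net_lt; rewrite ltnn.
Qed.

Lemma mem_net m k : (k \in net m) = (k < m)%N && (k \in net k.+1).
Proof.
elim: m => [|m IH]; first by rewrite in_nil.
have [->|km] := eqVneq k m; first by rewrite ltnSn.
have -> : (k < m.+1)%N = (k < m)%N by lia.
by rewrite -IH /=; case: ifP => // _; rewrite mem_rcons inE (negPf km).
Qed.

Lemma net_prefix m k j : (j < k)%N -> j \in net m -> j \in net k.
Proof. by move=> jk; rewrite mem_net => /andP[_ jj]; rewrite mem_net jk. Qed.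

Lemma net_far m j k : j \in net m -> k \in net m -> (j < k)%N -> delta / 4 < d j k.
Proof.
move=> jm; rewrite mem_net => /andP[_]; rewrite net_self => /allP h jk; apply: h.
exact: net_prefix jm.
Qed.

Lemma net_uniq m : uniq (net m).
Proof.
elim: m => //= m IH; case: ifP => // _; rewrite rcons_uniq IH andbT.
by apply/negP => /net_lt; rewrite ltnn.
Qed.

Lemma owner_some m y j : owner m y = Some j ->
  [/\ j \in net m, c j y & forall k, k \in net m -> (k < j)%N -> ~~ c k y].
Proof.
elim: m j => // m IH j /=; case E: (owner m y) => [i|].
  move=> [<-]; have [im ci h] := IH _ E; split => //.
    by rewrite [i \in _](mem_net m.+1) ltnS (ltnW (net_lt im)) /=;
       move: im; rewrite mem_net => /andP[].
  move=> k km ki; apply: h => //; rewrite mem_net (ltn_trans ki (net_lt im)).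
  by move: km; rewrite (mem_net m.+1) => /andP[].
case: ifP => // /andP[mn cm] [<-]; split => // k km kltm.
have {km kltm} : k \in net m.
  by rewrite mem_net kltm; move: km; rewrite (mem_net m.+1) => /andP[].
(* Since [y] has no owner among the first [m] centres, no net point before [m] covers it. *)
clear -E; elim: m E => // m IH /=.
case E: (owner m y) => [//|]; case: ifP => // h _.
rewrite (mem_net m.+1) ltnS leq_eqVlt => /andP[/orP[/eqP ->|km] kn].
  by move: h; rewrite kn => /negbT.
by apply: IH => //; rewrite mem_net km.
Qed.

Lemma owner_none m y k : owner m y = None -> k \in net m -> ~~ c k y.
Proof.
elim: m => // m IH /=.
case E: (owner m y) => [//|]; case: ifP => // h _.
rewrite (mem_net m.+1) ltnS leq_eqVlt => /andP[/orP[/eqP ->|km] kn].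
  by move: h; rewrite kn => /negbT.
by apply: IH => //; rewrite mem_net km.
Qed.

Lemma owner_step m y j : owner m y = Some j -> owner m.+1 y = Some j.
Proof. by move=> /= ->. Qed.

Lemma hub_step m j : hub m = Some j -> hub m.+1 = Some j.
Proof. by move=> /= ->. Qed.

Lemma bad_step m j : bad m j -> bad m.+1 j.
Proof.
move=> /existsP[l /existsP[l' h]]; apply/existsP.
exists (widen_ord (leqnSn m) l); apply/existsP.
by exists (widen_ord (leqnSn m) l').
Qed.

Lemma hub_bad m j : hub m = Some j -> (j < m)%N && bad m j.
Proof.
elim: m => // m IH /=; case: (hub m) IH => [i h /h|_].
  by move=> /andP[im /bad_step ->]; rewrite ltnS ltnW.
by case: pickP => //= i bi [<-]; rewrite ltn_ord.
Qed.

Lemma hub_none m j : hub m = None -> (j < m)%N -> ~~ bad m j.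
Proof.
case: m => // m /=; case: (hub m) => //; case: pickP => //= h _ jm.
by have /negbT := h (Ordinal jm).
Qed.

(** The first net ball that meets the pair contains exactly one of its points, since otherwise it
    would own both. *)
Lemma cut_center m y z : owner m y != owner m z ->
  exists j, [/\ j \in net m, c j y != c j z &
    forall k, k \in net m -> (k < j)%N -> ~~ c k y && ~~ c k z].
Proof.
(* By symmetry [y] has the earlier owner, where having no owner counts as last. *)
wlog: y z / match owner m y, owner m z with
            | Some a, Some b => (a < b)%N | Some _, None => True | _, _ => False end.
  move=> W; case Ey: (owner m y) => [a|]; case Ez: (owner m z) => [b|] // ne.
  - have [ab|ba|ab] := ltngtP a b.
    + by apply: W; rewrite Ey Ez.
    + have [||j [jm cj h]] := W z y; rewrite ?Ey ?Ez 1?eq_sym //.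
      exists j; split; rewrite 1?eq_sym // => k km kj; rewrite andbC; exact: h.
    + by rewrite ab eqxx in ne.
  - by apply: W; rewrite Ey Ez.
  - have [||j [jm cj h]] := W z y; rewrite ?Ey ?Ez 1?eq_sym //.
    exists j; split; rewrite 1?eq_sym // => k km kj; rewrite andbC; exact: h.
case Ey: (owner m y) => [a|]; case Ez: (owner m z) => [b|] //.
- move=> ab _; have [am ca ha] := owner_some Ey; have [bm cb hb] := owner_some Ez.
  exists a; rewrite ca (negPf (hb _ am ab)); split => // k km ka.
  by rewrite ha // hb // (ltn_trans ka).
- move=> _ _; have [am ca ha] := owner_some Ey; have hz := owner_none Ez.
  by exists a; rewrite ca (negPf (hz _ am)); split => // k km ka; rewrite ha // hz.
Qed.

Hypothesis d_refl : forall k, d k k = 0.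
Hypothesis d_sym : forall j k, d j k = d k j.
Hypothesis d_tri : forall i j k, d i k <= d i j + d j k.
Hypothesis delta_gt0 : 0 < delta.
Hypothesis N_ge1 : 1 <= N.
Hypothesis c_near : forall j y, d j y <= delta / 4 -> c j y.
Hypothesis c_far : forall j y, c j y -> d j y <= delta / 2.

Lemma d_ge0 j k : 0 <= d j k.
Proof. by have := d_tri j k j; rewrite d_refl (d_sym k j); lra. Qed.

(** A point kept out of the net was rejected because of an earlier net point this close. *)
Lemma net_cover m y : (y < m)%N -> exists2 j, j \in net m & d j y <= delta / 4.
Proof.
move=> ym; suff [j jn h] : exists2 j, j \in net y.+1 & d j y <= delta / 4.
  by exists j => //; apply: (net_prefix _ jn); have := net_lt jn; lia.
case E: (y \in net y.+1).
  by exists y => //; rewrite d_refl; apply/ltW/divr_gt0.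
move: E; rewrite net_self => /negbT/allPn[j jn]; rewrite -leNgt => h.
exists j => //; apply: (net_prefix _ jn); have := net_lt jn; lia.
Qed.

Lemma owner_lt m y : (y < m)%N -> exists j, owner m y = Some j.
Proof.
move=> ym; case E: (owner m y) => [j|]; first by exists j.
have [j jn dj] := net_cover ym.
by have := owner_none E jn; rewrite c_near.
Qed.

(** Owners and the hub never change once set, and the appearance of a hub only identifies labels.
    This is monotonicity at one scale. *)
Lemma parted_step m y z : (y < m)%N -> (z < m)%N ->
  parted m.+1 y z -> parted m y z.
Proof.
move=> /owner_lt[a Ea] /owner_lt[b Eb]; apply: contra; rewrite /label.
rewrite (owner_step Ea) (owner_step Eb) Ea Eb.
case Eh: (hub m) => [k|]; first by rewrite (hub_step Eh).
by move=> /eqP ->.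
Qed.

(** The worst case joins two owners through the hub, which costs [1/2 + 2 + 2 + 1/2] times
    [delta]. *)
Lemma unparted_dist m y z : (y < m)%N -> (z < m)%N ->
  ~~ parted m y z -> d y z <= 5 * delta.
Proof.
have dpos := delta_gt0.
move=> /owner_lt[a Ea] /owner_lt[b Eb]; rewrite negbK /label Ea Eb.
have [_ /c_far ha _] := owner_some Ea; have [_ /c_far hb _] := owner_some Eb.
have E : a = b -> d y z <= 5 * delta.
  move=> E; rewrite -E in hb; have := d_tri y a z; rewrite (d_sym y a); lra.
case: (hub m) => [k|/eqP //].
case: ifP => h1; case: ifP => h2 /eqP // kE.
- have := d_tri y a z; have := d_tri a k z; have := d_tri k b z.
  by rewrite (d_sym y a) (d_sym a k); lra.
- have := d_tri y a z; have := d_tri a k z; move: hb; rewrite -kE.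
  by rewrite (d_sym y a) (d_sym a k); lra.
- have := d_tri z b y; have := d_tri b k y; move: ha; rewrite kE.
  by rewrite (d_sym z b) (d_sym b k) (d_sym y z); lra.
Qed.

(** At such a scale every ball contains all points, so the first net point owns everything. *)
Lemma unparted_small m y z : (y < m)%N -> (z < m)%N ->
  (forall k l, (k < m)%N -> (l < m)%N -> d k l <= delta / 4) ->
  ~~ parted m y z.
Proof.
move=> ym zm small; have [a Ea] := owner_lt ym; have [b Eb] := owner_lt zm.
have [an _ ha] := owner_some Ea; have [bn _ hb] := owner_some Eb.
suff E : a = b by rewrite negbK /label Ea Eb E.
have [ab|ba|//] := ltngtP a b.
  by have := hb _ an ab; rewrite c_near // small // net_lt.
by have := ha _ bn ba; rewrite c_near // small // net_lt.
Qed.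

Lemma parted_owner m y z : parted m y z -> owner m y != owner m z.
Proof. by apply: contraNneq; rewrite /label => ->. Qed.

(* The clusters touched closely by the boundary of the hub have been merged
   with it, so a cut close pair betrays a second bad centre. *)
Lemma parted_close m y z : (y < m)%N -> (z < m)%N ->
  N * d y z <= delta -> parted m y z ->
  exists j k, [/\ (j < m)%N, (k < m)%N, j != k, c j y != c j z & bad m k].
Proof.
have dpos := delta_gt0.
move=> ym zm close sep; have [a Ea] := owner_lt ym; have [b Eb] := owner_lt zm.
have [/net_lt am ca _] := owner_some Ea; have [/net_lt bm cb _] := owner_some Eb.
have dyz : d y z <= delta.
  by apply: le_trans close; rewrite ler_peMl // d_ge0.
(* This fixes the merging radius in [label]: owners of points within [delta] of each other are
   within [1/2 + 1 + 1/2] times [delta]. *)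
have dab : d a b <= 2 * delta.
  have := c_far ca; have := c_far cb; have := d_tri a y b; have := d_tri y z b.
  by rewrite (d_sym z b); lra.
have badP j : c j y != c j z -> bad m j.
  move=> cj; apply/existsP; exists (Ordinal ym); apply/existsP.
  by exists (Ordinal zm); rewrite /= close cj.
have [j [jn cj first_j]] := cut_center (parted_owner sep).
have jm := net_lt jn.
(* The ball that first cuts the pair contains one of its points and therefore owns it. *)
have jab : j = a \/ j = b.
  case: (boolP (c j y)) => cy.
    left; have [an _ ha] := owner_some Ea.
    have [ja|aj|//] := ltngtP j a; first by have := ha _ jn ja; rewrite cy.
    by have := first_j _ an aj; rewrite ca.
  right; have cz : c j z by move: cj; rewrite (negPf cy); case: (c j z).
  have [bn _ hb] := owner_some Eb.
  have [jb|bj|//] := ltngtP j b; first by have := hb _ jn jb; rewrite cz.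
  by have := first_j _ bn bj; rewrite cb andbF.
case Eh: (hub m) => [k|]; last by have := hub_none Eh jm; rewrite badP.
have /andP[km bk] := hub_bad Eh.
(* If the cutting centre were the hub, the other owner would be within [2 * delta] of it, and both
   points would bear the label of the hub. *)
exists j, k; split => //; apply/eqP => jk.
move: sep; rewrite /parted /label Ea Eb Eh.
have d2 : 0 <= 2 * delta by rewrite mulr_ge0 // ltW.
case: jab => E; rewrite -jk E d_refl d2; last by rewrite d_sym dab eqxx.
by rewrite dab eqxx.
Qed.

End Level.

(** The clustering of the first [m] points only looks at indices below [m]. This gives consistency
    when the sequence grows, and measurability, since only finitely many values of [c] matter. *)
Lemma eq_parted (R : realType) (d d' : nat -> nat -> R) (delta N : R)
    (c c' : nat -> nat -> bool) (m : nat) :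
  (forall j k, (j < m)%N -> (k < m)%N -> d j k = d' j k) ->
  (forall j k, (j < m)%N -> (k < m)%N -> c j k = c' j k) ->
  forall y z, (y < m)%N -> (z < m)%N ->
  parted d delta N c m y z = parted d' delta N c' m y z.
Proof.
move=> dd cc y z ym zm.
have En k : (k <= m)%N -> net d delta k = net d' delta k.
  elim: k => //= k IH km; rewrite IH; last exact: ltnW.
  rewrite (_ : all _ _ = all (fun j => delta / 4 < d' j k) (net d' delta k)) //.
  by apply: eq_in_all => j /net_lt jk; rewrite dd //; lia.
have Eo x k : (x < m)%N -> (k <= m)%N ->
    owner d delta c k x = owner d' delta c' k x.
  move=> xm; elim: k => // k IH km.
  rewrite [LHS]/= [RHS]/= -/(net d delta k.+1) -/(net d' delta k.+1).
  by rewrite IH ?En ?cc //; exact: ltnW.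
have Eb j k : (j < m)%N -> (k <= m)%N ->
    bad d delta N c k j = bad d' delta N c' k j.
  move=> jm km; apply: eq_existsb => l; apply: eq_existsb => l'.
  have lm := leq_trans (ltn_ord l) km; have lm' := leq_trans (ltn_ord l') km.
  by rewrite dd // !cc.
have Eh k : (k <= m)%N -> hub d delta N c k = hub d' delta N c' k.
  elim: k => //= k IH km; rewrite IH; last exact: ltnW.
  case: (hub d' delta N c' k) => //; congr (omap _ _); apply: eq_pick => j.
  by apply: Eb => //; apply: leq_trans km; apply: ltn_ord.
have El x : (x < m)%N -> label d delta N c m x = label d' delta N c' m x.
  move=> xm; rewrite /label Eo // Eh //.
  case E: (owner d' delta c' m x) => [j|//].
  case E': (hub d' delta N c' m) => [k|//].
  have [/net_lt jm _ _] := owner_some E.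
  have /andP[km _] := hub_bad E'.
  by rewrite dd.
by rewrite /parted !El.
Qed.

(** * The ultrametric of all scales *)

Lemma exists_scale (R : archiRealFieldType) (x : R) : 0 < x ->
  exists i : int, 2 ^ i <= x < 2 ^ (i + 1).
Proof.
move=> x0.
have big (y : R) : exists n : nat, y < 2 ^+ n.
  exists (Num.bound `|y|); apply: le_lt_trans (ler_norm _) _.
  apply: lt_trans (archi_boundP (normr_ge0 y)) _.
  by rewrite -natrX ltr_nat ltn_expl.
have [M hM] := big x^-1; have [K hK] := big x.
have ex : exists n : nat, x < 2 ^ (n%:Z - M%:Z).
  exists (K + M)%N; rewrite PoszD addrK; exact: hK.
(* Shifting by [M] turns the search for the exponent into one over natural numbers. The minimum is
   not 0, because [M] was chosen with [2 ^ (- M) < x]. *)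
have [[|n] xn nmin] := ex_minnP ex.
  have : 2 ^ (0%:Z - M%:Z) < x.
    by rewrite sub0r -invr_expz -[x]invrK ltf_pV2 ?posrE ?invr_gt0 ?exprn_gt0.
  by move=> /(lt_trans xn); rewrite ltxx.
exists (n%:Z - M%:Z); rewrite leNgt; apply/andP; split.
  by apply/negP => /nmin; rewrite ltnn.
by rewrite (_ : _ + 1 = n.+1%:Z - M%:Z) //; lia.
Qed.

Lemma sup_le_nneg (R : realType) (E : set R) (x : R) :
  0 <= x -> ubound E x -> sup E <= x.
Proof.
move=> x0 Ex; have [->|/set0P E0] := eqVneq E set0; first by rewrite sup0.
exact: ge_sup.
Qed.

(* With [x] uniform on [0, 1], [Phi t] is the probability that the radius, as
   a multiple of the scale, is at least [t]. *)
Definition covers (R : realType) (Phi : R -> R) (x t : R) : bool :=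
  (t <= 4^-1) || ((t <= 2^-1) && (x <= Phi t)).

Section Embedding.
Variables (R : realType) (Phi : R -> R) (N : R).
Hypothesis N_ge1 : 1 <= N.

Definition apart (d : nat -> nat -> R) (U : nat -> R) (delta : R) (m y z : nat) :=
  parted d delta N (fun j k => covers Phi (U j) (d j k / delta)) m y z.

(** The factor 10 is what domination asks for: points merged at scale [2 ^ (i + 1)] are at distance
    at most [5 * 2 ^ (i + 1)]. *)
Definition scale_set d U m y z : set R :=
  [set r | exists2 i : int, apart d U (2 ^ i) m y z & r = 10 * 2 ^ i].

(* [sup] is 0 on the empty set, which is the right value when [y = z]. *)
Definition ultra d U m y z : R := sup (scale_set d U m y z).

Lemma eq_ultra d d' U m y z :
  (forall j k, (j < m)%N -> (k < m)%N -> d j k = d' j k) ->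
  (y < m)%N -> (z < m)%N -> ultra d U m y z = ultra d' U m y z.
Proof.
move=> dd ym zm; congr sup; apply/seteqP.
have E i : apart d U (2 ^ i) m y z = apart d' U (2 ^ i) m y z.
  by apply: eq_parted => // j k jm km; rewrite dd.
by split=> r [i s ->]; exists i => //; move: s; rewrite E.
Qed.

Variables (d : nat -> nat -> R) (U : nat -> R).
Hypothesis d_refl : forall k, d k k = 0.
Hypothesis d_sym : forall j k, d j k = d k j.
Hypothesis d_tri : forall i j k, d i k <= d i j + d j k.

Lemma covers_near delta j y : 0 < delta ->
  d j y <= delta / 4 -> covers Phi (U j) (d j y / delta).
Proof. by move=> d0 h; rewrite /covers ler_pdivrMr // mulrC h. Qed.

Lemma covers_far delta j y : 0 < delta ->
  covers Phi (U j) (d j y / delta) -> d j y <= delta / 2.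
Proof.
move=> d0 /orP[|/andP[+ _]]; rewrite ler_pdivrMr //; last by rewrite mulrC.
by lra.
Qed.

(** The sum of all distances is a crude bound for the diameter. It bounds the separating scales
    above, uniformly in the radii. *)
Lemma apart_bounded m delta y z : (y < m)%N -> (z < m)%N ->
  0 < delta -> apart d U delta m y z ->
  delta <= 4 * \sum_(k < m) \sum_(l < m) d k l.
Proof.
move=> ym zm d0; apply: contraTT; rewrite -ltNge => h.
have dd0 := d_ge0 d_refl d_sym d_tri.
apply: unparted_small => // [j w|k l km lm]; first exact: covers_near.
apply: (@le_trans _ _ (\sum_(k < m) \sum_(l < m) d k l)); last by lra.
rewrite (bigD1 (Ordinal km)) //= (bigD1 (Ordinal lm)) //= -addrA lerDl.
by rewrite addr_ge0 ?sumr_ge0 // => i _; rewrite sumr_ge0.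
Qed.

Lemma apart_low m delta y z : (y < m)%N -> (z < m)%N ->
  0 < delta -> 5 * delta < d y z -> apart d U delta m y z.
Proof.
move=> ym zm d0; apply: contraTT; rewrite -leNgt.
apply: unparted_dist => // j w; [exact: covers_near | exact: covers_far].
Qed.

Let two_gt0 (i : int) : 0 < 2 ^ i :> R.
Proof. exact: exprz_gt0. Qed.

Lemma scale_set_ub m y z : (y < m)%N -> (z < m)%N ->
  has_ubound (scale_set d U m y z).
Proof.
move=> ym zm; exists (10 * (4 * \sum_(k < m) \sum_(l < m) d k l)).
by move=> _ [i s ->]; rewrite ler_pM2l //; apply: apart_bounded s.
Qed.

Lemma ultra_ge m y z i : (y < m)%N -> (z < m)%N ->
  apart d U (2 ^ i) m y z -> 10 * 2 ^ i <= ultra d U m y z.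
Proof. by move=> ym zm s; apply: ub_le_sup; [apply: scale_set_ub | exists i]. Qed.

Lemma ultra_ge0 m y z : (y < m)%N -> (z < m)%N -> 0 <= ultra d U m y z.
Proof.
move=> ym zm; have [E|/set0P[_ [i s _]]] := eqVneq (scale_set d U m y z) set0.
  by rewrite /ultra E sup0.
by apply: le_trans (ultra_ge ym zm s); rewrite mulr_ge0 // ltW.
Qed.

Lemma ultra_refl m y : ultra d U m y y = 0.
Proof.
rewrite /ultra (_ : scale_set _ _ _ _ _ = set0) ?sup0 //.
by rewrite -subset0 => r [i]; rewrite /apart /parted eqxx.
Qed.

Lemma ultra_sym m y z : ultra d U m y z = ultra d U m z y.
Proof.
congr sup; apply/seteqP; split=> r [i s ->]; exists i => //.
  by rewrite /apart /parted eq_sym.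
by rewrite /apart /parted eq_sym.
Qed.

(** Having equal labels is an equivalence relation at each scale, so a scale separating [x] from [z]
    also separates one of them from [y]. The partitions of different scales need not be nested. *)
Lemma ultra_max m x y z : (x < m)%N -> (y < m)%N -> (z < m)%N ->
  ultra d U m x z <= Num.max (ultra d U m x y) (ultra d U m y z).
Proof.
move=> xm ym zm; apply: sup_le_nneg; first by rewrite le_max ultra_ge0.
move=> _ [i s ->]; rewrite le_max.
have [E|sxy] := eqVneq (label d (2 ^ i) N
    (fun j k => covers Phi (U j) (d j k / 2 ^ i)) m x)
    (label d (2 ^ i) N (fun j k => covers Phi (U j) (d j k / 2 ^ i)) m y).
  by rewrite orbC ultra_ge //; move: s; rewrite /apart /parted E.
by rewrite ultra_ge.
Qed.

Lemma ultra_dominates m y z : (y < m)%N -> (z < m)%N ->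
  d y z <= ultra d U m y z.
Proof.
move=> ym zm; have [d0|d0] := leP (d y z) 0.
  exact: le_trans d0 (ultra_ge0 ym zm).
(* Here [10 * 2 ^ i <= d y z < 20 * 2 ^ i]. If scale [i + 1] separates, the output is at least
   [20 * 2 ^ i]. Otherwise [d y z <= 10 * 2 ^ i], and scale [i], which surely separates, is
   enough. *)
have [i /andP[]] := exists_scale (divr_gt0 d0 (ltr0Sn R 9)).
rewrite ler_pdivlMr // ltr_pdivrMr // exprzDr ?unitfE ?pnatr_eq0 // expr1z => i1 i2.
have i0 := two_gt0 i.
have [s|/(contra (apart_low ym zm (two_gt0 (i + 1))))] :=
    boolP (apart d U (2 ^ (i + 1)) m y z).
  apply: le_trans (ultra_ge ym zm s).
  by rewrite exprzDr ?unitfE ?pnatr_eq0 // expr1z; lra.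
rewrite -leNgt exprzDr ?unitfE ?pnatr_eq0 // expr1z => le_d.
apply: (@le_trans _ _ (10 * 2 ^ i)); first by lra.
by apply/ultra_ge/apart_low => //; lra.
Qed.

Lemma ultra_step m y z : (y < m)%N -> (z < m)%N ->
  ultra d U m.+1 y z <= ultra d U m y z.
Proof.
move=> ym zm; apply: sup_le_nneg; first exact: ultra_ge0.
move=> _ [i s ->]; apply: ultra_ge => //.
by apply: parted_step s => // j w; apply: covers_near.
Qed.

End Embedding.

(** Small scales always separate and large ones never do, so finitely many scales, chosen
    independently of [U], determine the distance. This makes it measurable and bounds its
    expectation by a finite sum. *)
Lemma ultra_bigmax (R : realType) (Phi : R -> R) (N : R) (d : nat -> nat -> R)
    (m y z : nat) : 1 <= N ->
  (forall k, d k k = 0) -> (forall j k, d j k = d k j) ->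
  (forall i j k, d i k <= d i j + d j k) ->
  (y < m)%N -> (z < m)%N -> 0 < d y z ->
  exists (s : R) (K : nat), [/\ 0 < s, s <= d y z, d y z < 16 * s &
    forall U, ultra Phi N d U m y z =
      \big[Num.max/0]_(k < K)
        (10 * (s * 2 ^+ k) * (apart Phi N d U (s * 2 ^+ k) m y z)%:R)].
Proof.
move=> N1 d_refl d_sym d_tri ym zm d0.
(* With [8 * 2 ^ i <= d y z] the lowest scale retained surely separates, so it stands in for all
   smaller ones. *)
have [i] := exists_scale (divr_gt0 d0 (ltr0Sn R 7)).
rewrite ler_pdivlMr // ltr_pdivrMr // exprzDr ?unitfE ?pnatr_eq0 // expr1z.
move=> /andP[i1 i2]; have s0 : 0 < 2 ^ i :> R by apply: exprz_gt0.
pose B := 4 * \sum_(k < m) \sum_(l < m) d k l.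
pose K := Num.bound (B / 2 ^ i); exists (2 ^ i), K.+1.
split => // [|| U]; [lra | lra | apply/le_anti/andP; split].
- apply: sup_le_nneg; first by apply: bigmax_ge_id.
  move=> _ [j a ->].
  have bB : 2 ^ j <= B by apply: (apart_bounded N1 d_refl d_sym d_tri ym zm _ a); apply: exprz_gt0.
  have B0 : 0 <= B by apply: le_trans bB; apply/ltW/exprz_gt0.
  have [ji|ij] := ltP j i.
    apply: le_trans (le_bigmax_cond _ _ (j := ord0) _) => //.
    rewrite expr0 mulr1 (_ : apart _ _ _ _ _ _ _ _ = true); last first.
      by apply: apart_low => //; lra.
    rewrite mulr1.
    by rewrite ler_pM2l // ler_weXz2l ?ler1n // ltW.
  have [k kE] : exists k : nat, j = i + k%:Z.
    by exists `|j - i|%N; lia.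
  move: a bB; rewrite kE exprzDr ?unitfE ?pnatr_eq0 // => a bB.
  have kK : (k < K.+1)%N.
    rewrite -(ltr_nat R); apply: (@lt_trans _ _ (2 ^+ k)).
      by rewrite -natrX ltr_nat ltn_expl.
    apply: (@le_lt_trans _ _ (B / 2 ^ i)); first by rewrite ler_pdivlMr // mulrC.
    apply: (@lt_trans _ _ K%:R); last by rewrite ltr_nat.
    by apply: archi_boundP; rewrite divr_ge0 // ltW.
  by apply: le_trans (le_bigmax_cond _ _ (j := Ordinal kK) _) => //=; rewrite a mulr1.
- apply: bigmax_le => [|k _]; first by apply: ultra_ge0.
  case a: (apart _ _ _ _ _ _ _ _); last by rewrite mulr0; apply: ultra_ge0.
  rewrite mulr1; move: a; rewrite (_ : 2 ^ i * 2 ^+ k = 2 ^ (i + k%:Z)).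
    exact: ultra_ge.
  by rewrite exprzDr ?unitfE ?pnatr_eq0.
Qed.

(** * Independent radii *)

Local Open Scope classical_set_scope.

(** The product space is built one factor at a time. The product formula for rectangles is the only
    form of independence used, and it does not constrain the coordinates from [n] on. *)
Lemma iid_family (dT : measure_display) (T : measurableType dT) (R : realType)
    (mu : probability T R) (n : nat) :
  exists (dd : measure_display) (Omega : measurableType dd)
      (P : probability Omega R) (U : nat -> Omega -> T),
    (forall k, measurable_fun setT (U k)) /\
    forall A : nat -> set T, (forall k, measurable (A k)) ->
      P [set w | forall k, (k < n)%N -> A k (U k w)] =
      (\prod_(k < n) fine (mu (A k)))%:E.
Proof.
elim: n => [|n [dd [Omega [P [U [mU iid]]]]]].
  exists dT, T, mu, (fun _ => id); split; first by move=> k; apply: measurable_id.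
  move=> A _; rewrite big_ord0 (_ : [set w | _] = setT) ?probability_setT //.
  by apply/seteqP; split.
exists _, (Omega * T)%type, (P \x mu)%E,
  (fun k w => if k == n then w.2 else U k w.1); split.
  move=> k; case: eqP => _; first exact: measurable_snd.
  exact: measurableT_comp (mU k) (measurable_fst).
move=> A mA; rewrite (_ : [set w | _] =
    [set w | forall k, (k < n)%N -> A k (U k w)] `*` A n).
  rewrite [LHS]product_measure1E //; first last.
    rewrite (_ : [set w | _] = \bigcap_(k in [set k | (k < n)%N]) (U k @^-1` A k)).
      by apply: bigcap_measurableType; move=> k _; rewrite -[_ @^-1` _]setTI; apply: mU.
    by apply/seteqP; split=> w h k; apply: h.
  apply: etrans (congr1 (fun z => (z * _)%E) (iid A mA)) _.
  by rewrite big_ord_recr /= EFinM fineK // fin_num_measure.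
apply/seteqP; split=> -[w x] /= h; last first.
  by case: h => h Ax k; rewrite ltnS leq_eqVlt; case: eqP => [-> //|_ /=]; apply: h.
split; last by have := h n (ltnSn n); rewrite eqxx.
by move=> k kn; have := h k (ltnW kn); rewrite (ltn_eqF kn).
Qed.

Lemma uniform_cdf (R : realType) (a : R) : 0 <= a <= 1 ->
  uniform_prob (@ltr01 R) `]-oo, a] = a%:E.
Proof.
move=> /andP[a0 a1]; rewrite /uniform_prob integral_uniform_pdf.
rewrite (_ : _ `&` _ = `[0, a]); last first.
  apply/seteqP; split=> x /=; rewrite !in_itv /=.
    by case=> xa /andP[x0 _]; rewrite x0.
  by move=> /andP[x0 xa]; rewrite xa x0 (le_trans xa).
rewrite (eq_integral (fun=> 1%:E)); last first.
  move=> x; rewrite inE /= in_itv /= /uniform_pdf => /andP[x0 xa].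
  by rewrite x0 (le_trans xa a1) subr0 invr1.
rewrite integral_cst //= mul1e lebesgue_measure_itv /= lte_fin.
case: ltP => [_|a0']; first by rewrite -EFinB subr0.
by rewrite (_ : a = 0) //; apply/le_anti; rewrite a0 a0'.
Qed.

(** * Probabilities of covering and cutting for one random ball *)

Section CoverProbability.
Variables (R : realType) (Phi : R -> R).
Hypothesis Phi01 : forall t, 0 <= Phi t <= 1.
Hypothesis Phi_anti : forall s t, s <= t -> Phi t <= Phi s.
Hypothesis Phi_near : forall t, t <= 4^-1 -> Phi t = 1.
Hypothesis Phi_far : forall t, 2^-1 < t -> Phi t = 0.

Let mu : probability _ R := uniform_prob (@ltr01 R).
Let cov t : set R := [set x | covers Phi x t].

Lemma covers_itv t : cov t = if t <= 4^-1 then setT else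
  if t <= 2^-1 then `]-oo, Phi t] else set0.
Proof.
apply/seteqP; rewrite /cov /covers; split=> x /=; case: ifP => //= _;
  by case: ifP => //= _; rewrite in_itv.
Qed.

Lemma covers_measurable t : measurable (cov t).
Proof. by rewrite covers_itv; case: ifP => // _; case: ifP. Qed.

Lemma covers_prob t : mu (cov t) = (Phi t)%:E.
Proof.
rewrite covers_itv; case: ifP => [h|_]; first by rewrite probability_setT Phi_near.
case: ifPn => [h|]; first exact: uniform_cdf.
by rewrite -ltNge => /Phi_far ->; rewrite measure0.
Qed.

Lemma covers_anti x s t : s <= t -> covers Phi x t -> covers Phi x s.
Proof.
move=> st /orP[h|/andP[h1 h2]]; apply/orP; first by left; apply: le_trans h.
right; rewrite (le_trans st h1); exact: le_trans h2 (Phi_anti st).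
Qed.

Lemma cut_measurable s t :
  measurable [set x | covers Phi x s != covers Phi x t].
Proof.
rewrite (_ : [set x | _] = (cov s `\` cov t) `|` (cov t `\` cov s)).
  by apply: measurableU; apply: measurableD; apply: covers_measurable.
apply/seteqP; split=> x /=; rewrite /cov /=.
  by case: (covers _ _ s); case: (covers _ _ t) => //= _; [left|right].
by case: (covers _ _ s); case: (covers _ _ t) => //= -[[]|[]] // _ /(_ isT).
Qed.

Lemma none_measurable s t :
  measurable [set x | ~~ covers Phi x s && ~~ covers Phi x t].
Proof.
rewrite (_ : [set x | _] = ~` (cov s `|` cov t)).
  by apply: measurableC; apply: measurableU; apply: covers_measurable.
apply/seteqP; split=> x /=; rewrite /cov /=.
  by case: (covers _ _ s); case: (covers _ _ t) => //= _ [].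
by case: (covers _ _ s); case: (covers _ _ t) => //= h; case: h; [left | left | right].
Qed.

(** Covering the farther point implies covering the nearer one, so the cut event is a difference of
    nested events. *)
Lemma cut_prob s t : s <= t ->
  fine (mu [set x | covers Phi x s != covers Phi x t]) = Phi s - Phi t.
Proof.
move=> st; rewrite (_ : [set x | _] = cov s `\` cov t).
  rewrite measureD; [|exact: covers_measurable|exact: covers_measurable|]; last first.
    by rewrite ltey_eq fin_num_measure //; apply: covers_measurable.
  rewrite (_ : cov s `&` cov t = cov t); last by apply: setIidr => x; apply: covers_anti.
  exact: (congr1 fine (congr2 (fun a b => (a - b)%E) (covers_prob s) (covers_prob t))).
apply/seteqP; split=> x /=; have := @covers_anti x _ _ st; rewrite /cov /=.
  by case: (covers _ _ s); case: (covers _ _ t) => //= /(_ isT).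
by case: (covers _ _ s); case: (covers _ _ t) => //= _ [a b] //; case: b.
Qed.

Lemma none_prob s t :
  fine (mu [set x | ~~ covers Phi x s && ~~ covers Phi x t]) =
  1 - Phi (Num.min s t).
Proof.
wlog st : s t / s <= t.
  move=> W; have /orP[|ts] := le_total s t; first exact: W.
  rewrite (_ : [set x | _] = [set x | ~~ covers Phi x t && ~~ covers Phi x s]).
    by rewrite W // minC.
  by apply/seteqP; split=> x /=; rewrite andbC.
rewrite (min_idPl st) (_ : [set x | _] = ~` cov s).
  rewrite probability_setC; last exact: covers_measurable.
  exact: (congr1 (fun a => fine (1 - a)%E) (covers_prob s)).
apply/seteqP; split=> x /=; have := @covers_anti x _ _ st; rewrite /cov /=.
  by case: (covers _ _ s); case: (covers _ _ t).
by case: (covers _ _ s); case: (covers _ _ t) => //= h; have := h isT.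
Qed.

End CoverProbability.

(** * Expected distance *)

Lemma measurable_fin_comp (dd : measure_display) (Omega : measurableType dd)
    (F : finType) (f : Omega -> F) (A : set F) :
  (forall a, measurable (f @^-1` [set a])) -> measurable (f @^-1` A).
Proof.
move=> mf; rewrite (_ : f @^-1` A = \bigcup_(a in A) f @^-1` [set a]).
  by apply: fin_bigcup_measurable => //; apply: finite_finset.
by apply/seteqP; split=> w /= => [Afw|[a Aa /= ->//]]; exists (f w).
Qed.

Lemma union_bound (dd : measure_display) (Omega : measurableType dd)
    (R : realType) (P : probability Omega R) (I : Type) (r : seq I) (Q : pred I)
    (A : I -> set Omega) (B : set Omega) :
  measurable B -> (forall i, measurable (A i)) ->
  B `<=` \big[setU/set0]_(i <- r | Q i) A i ->
  fine (P B) <= \sum_(i <- r | Q i) fine (P (A i)).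
Proof.
move=> mB mA; elim: r B mB => [|i r IH] B mB; rewrite ?big_nil ?big_cons.
  by rewrite subset0 => ->; rewrite measure0.
case: ifP => Qi; last exact: IH.
move=> BA; set C := \big[_/_]_(_ <- r | _) _ in BA.
have mC : measurable C by apply: bigsetU_measurable.
apply: (@le_trans _ _ (fine (P (A i `|` C)))).
  apply: fine_le; rewrite ?fin_num_measure //; first exact: measurableU.
  by apply: le_measure; rewrite ?inE //; apply: measurableU.
apply: (@le_trans _ _ (fine (P (A i)) + fine (P C))).
  rewrite -fineD ?fin_num_measure //; apply: fine_le.
  - by apply: fin_num_measure; apply: measurableU.
  - by rewrite fin_numD !fin_num_measure.
  - exact: measureU2.
by rewrite lerD2l; apply: IH.
Qed.

Lemma bool_indicE (T : Type) (R : realType) (b : T -> bool) :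
  (fun w => (b w)%:R) = \1_[set w | b w] :> (T -> R).
Proof.
apply/funext => w; rewrite indicE; congr (nat_of_bool _)%:R.
by apply/idP/idP => h; [apply/mem_set | move/set_mem: h].
Qed.

Lemma measurable_bool_indic (dd : measure_display) (Omega : measurableType dd)
    (R : realType) (b : Omega -> bool) :
  measurable [set w | b w] -> measurable_fun setT (fun w => (b w)%:R : R).
Proof. by move=> mb; rewrite bool_indicE; apply: measurable_indic. Qed.

Lemma measurable_bigmax (dd : measure_display) (Omega : measurableType dd)
    (R : realType) (K : nat) (F : 'I_K -> Omega -> R) :
  (forall k, measurable_fun setT (F k)) ->
  measurable_fun setT (fun w => \big[Num.max/0]_(k < K) F k w).
Proof.
elim: K F => [|K IH] F mF.
  rewrite [X in measurable_fun _ X](_ : _ = cst 0); first exact: measurable_cst.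
  by apply/funext => w; rewrite big_ord0.
rewrite [X in measurable_fun _ X](_ : _ = F ord0 \max
  (fun w => \big[Num.max/0]_(k < K) F (lift ord0 k) w)); last first.
  by apply/funext => w; rewrite big_ord_recl.
by apply: measurable_maxr => //; apply: IH.
Qed.

Lemma integral_sum_bool (dd : measure_display) (Omega : measurableType dd)
    (R : realType) (P : probability Omega R) (K : nat) (c : 'I_K -> R)
    (b : 'I_K -> Omega -> bool) :
  (forall k, 0 <= c k) -> (forall k, measurable [set w | b k w]) ->
  (\int[P]_w (\sum_(k < K) c k * (b k w)%:R)%:E)%E =
  (\sum_(k < K) c k * fine (P [set w | b k w]))%:E.
Proof.
move=> c0 mb.
have E k : (fun w => (c k * (b k w)%:R)%:E) =
    (fun w => (c k)%:E * (\1_[set w | b k w] w)%:E)%E.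
  by apply/funext => w; rewrite EFinM -bool_indicE.
have m1 k : measurable_fun setT (fun w => (\1_[set w | b k w] w)%:E : \bar R).
  by apply/measurable_EFinP; apply: measurable_indic.
under eq_integral do rewrite -sumEFin.
rewrite ge0_integral_sum //; first last.
- by move=> k w _; rewrite lee_fin mulr_ge0.
- by move=> k; rewrite E; apply: measurable_funeM.
rewrite -sumEFin; apply: eq_bigr => k _; rewrite E ge0_integralZl //.
- by rewrite integral_indic // setIT EFinM fineK // fin_num_measure.
- by move=> w _; rewrite lee_fin.
- by rewrite lee_fin.
Qed.

(** The terms halve with [k], and the first one that the condition admits is at most 1. *)
Lemma geometric_tail (R : realType) (x A : R) (K : nat) : 0 <= x -> 0 < A ->
  \sum_(k < K | x <= A * 2 ^+ k) x / (A * 2 ^+ k) <= 2.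
Proof.
move=> x0.
have geo k : \sum_(i < k) 2^-1 ^+ i <= 2 :> R.
  elim: k => [|k IH]; first by rewrite big_ord0.
  rewrite big_ord_recl expr0.
  have -> : \sum_(i < k) 2^-1 ^+ lift ord0 i = 2^-1 * \sum_(i < k) 2^-1 ^+ i :> R.
    by rewrite mulr_sumr; apply: eq_bigr => i _; rewrite lift0 exprS.
  by lra.
elim: K A => [|K IH] A A0; first by rewrite big_ord0.
have half B : 0 < B -> \sum_(k < K) x / (B * 2 ^+ k) <= 2 * (x / B).
  move=> B0; have -> : \sum_(k < K) x / (B * 2 ^+ k) =
      (x / B) * \sum_(k < K) (2^-1) ^+ k.
    by rewrite mulr_sumr; apply: eq_bigr => k _; rewrite invfM exprVn mulrA.
  by rewrite mulrC; apply: ler_wpM2r; rewrite ?divr_ge0 // ltW.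
rewrite big_mkcond big_ord_recl expr0 mulr1 /=.
rewrite (eq_bigr (fun k : 'I_K => if x <= 2 * A * 2 ^+ k then x / (2 * A * 2 ^+ k) else 0)); last first.
  move=> k _; suff -> : A * 2 ^+ (lift ord0 k) = 2 * A * 2 ^+ k by [].
  by rewrite lift0 exprS -[RHS]mulrA mulrCA.
rewrite -big_mkcond /=; case: ifP => xA; last by rewrite add0r IH // mulr_gt0.
have xA1 : x / A <= 1 by rewrite ler_pdivrMr // mul1r.
have A2 : 0 < 2 * A by rewrite mulr_gt0.
suff : \sum_(k < K | x <= 2 * A * 2 ^+ k) x / (2 * A * 2 ^+ k) <= x / A by lra.
rewrite big_mkcond; apply: le_trans (_ : \sum_(k < K) x / (2 * A * 2 ^+ k) <= _).
  apply: ler_sum => k _; case: ifP => // _.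
  by rewrite divr_ge0 // mulr_ge0 // ?exprn_ge0 // ltW.
by apply: le_trans (half _ A2) _; rewrite invfM; lra.
Qed.

(* The [j]-th term is the probability that the ball of [j] is the first to
   meet [{y, z}] and cuts it. *)
Definition cut_bound (R : realType) (Phi : R -> R) (d : nat -> nat -> R)
    (delta : R) (m y z : nat) : R :=
  let near j := Num.min (d j y / delta) (d j z / delta) in
  let far j := Num.max (d j y / delta) (d j z / delta) in
  \sum_(j <- net d delta m)
    (\prod_(k < j) (1 - (if (k : nat) \in net d delta m then Phi (near k) else 0))) *
    (Phi (near j) - Phi (far j)).

Section Expectation.
Variables (R : realType) (Phi : R -> R).
Hypothesis Phi01 : forall t, 0 <= Phi t <= 1.
Hypothesis Phi_anti : forall s t, s <= t -> Phi t <= Phi s.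
Hypothesis Phi_near : forall t, t <= 4^-1 -> Phi t = 1.
Hypothesis Phi_far : forall t, 2^-1 < t -> Phi t = 0.
Variables (n : nat) (dd : measure_display) (Omega : measurableType dd)
  (P : probability Omega R) (U : nat -> Omega -> R).
Let mu : probability _ R := uniform_prob (@ltr01 R).
Hypothesis mU : forall k, measurable_fun setT (U k).
Hypothesis iid : forall A : nat -> set R, (forall k, measurable (A k)) ->
  P [set w | forall k, (k < n)%N -> A k (U k w)] =
  (\prod_(k < n) fine (mu (A k)))%:E.
Variables (N : R) (d : nat -> nat -> R) (m : nat).
Hypothesis N_ge1 : 1 <= N.
Hypothesis mn : (m <= n)%N.
Hypothesis d_refl : forall k, d k k = 0.
Hypothesis d_sym : forall j k, d j k = d k j.
Hypothesis d_tri : forall i j k, d i k <= d i j + d j k.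

Let d0 j k : 0 <= d j k := d_ge0 d_refl d_sym d_tri j k.

Let cutset (t t' : R) : set R := [set x | covers Phi x t != covers Phi x t'].

Lemma measurable_coord k (A : set R) : measurable A -> measurable [set w | A (U k w)].
Proof. by move=> mA; rewrite -[[set w | _]]setTI; apply: mU. Qed.

(** By [eq_parted] the event factors through the finite table [f] of coverage bits. *)
Lemma apart_measurable delta y z : (y < m)%N -> (z < m)%N ->
  measurable [set w | apart Phi N d (U ^~ w) delta m y z].
Proof.
move=> ym zm.
pose f w : {ffun 'I_m * 'I_m -> bool} :=
  [ffun p : 'I_m * 'I_m => covers Phi (U p.1 w) (d p.1 p.2 / delta)].
pose ext (a : {ffun 'I_m * 'I_m -> bool}) j k :=
  [exists p : 'I_m * 'I_m, [&& p.1 == j :> nat, p.2 == k :> nat & a p]].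
have extE w j k : (j < m)%N -> (k < m)%N ->
    covers Phi (U j w) (d j k / delta) = ext (f w) j k.
  move=> jm km; apply/idP/existsP => [h|[p /and3P[/eqP <- /eqP <-]]].
    by exists (Ordinal jm, Ordinal km); rewrite /= !eqxx ffunE.
  by rewrite ffunE.
rewrite (_ : [set w | _] = f @^-1` [set a | parted d delta N (ext a) m y z]).
  apply: measurable_fin_comp => a.
  rewrite (_ : f @^-1` _ = \bigcap_(p in [set: 'I_m * 'I_m])
      [set w | covers Phi (U p.1 w) (d p.1 p.2 / delta) == a p]).
    apply: fin_bigcap_measurable => [|p _]; first exact: finite_finset.
    have mc := measurable_coord p.1 (covers_measurable Phi (d p.1 p.2 / delta)).
    case: (a p); last rewrite (_ : [set w | _] = ~` [set w | covers Phi (U p.1 w) (d p.1 p.2 / delta)]).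
    - by rewrite (_ : [set w | _] = [set w | covers Phi (U p.1 w) (d p.1 p.2 / delta)]) //; apply/seteqP; split=> w /eqP.
    - exact: measurableC.
    - by apply/seteqP; split=> w /=; [move/eqP => -> | move/negP/negPf => ->].
  apply/seteqP; split=> w /= => [<- p _ /=|h]; first by rewrite ffunE.
  by apply/ffunP => p; rewrite ffunE; apply/eqP/h.
apply/seteqP; split=> w /=; rewrite /apart.
  by rewrite (eq_parted _ _ (fun j k jm km => erefl) (extE w) ym zm).
by rewrite (eq_parted _ _ (fun j k jm km => erefl) (extE w) ym zm).
Qed.

Let weight delta y z k : R :=
  if k \in net d delta m then Phi (Num.min (d k y / delta) (d k z / delta)) else 0.

(** The net does not depend on the radii, so the event constrains each radius separately and its
    probability factors. *)
Lemma first_prob delta y z j : j \in net d delta m ->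
  measurable [set w | covers Phi (U j w) (d j y / delta) != covers Phi (U j w) (d j z / delta) /\
     forall k, k \in net d delta m -> (k < j)%N ->
       ~~ covers Phi (U k w) (d k y / delta) && ~~ covers Phi (U k w) (d k z / delta)] /\
  fine (P [set w | covers Phi (U j w) (d j y / delta) != covers Phi (U j w) (d j z / delta) /\
     forall k, k \in net d delta m -> (k < j)%N ->
       ~~ covers Phi (U k w) (d k y / delta) && ~~ covers Phi (U k w) (d k z / delta)]) =
  (\prod_(k < j) (1 - weight delta y z k)) *
  fine (mu (cutset (d j y / delta) (d j z / delta))).
Proof.
move=> jn; have jm := net_lt jn; have jln : (j < n)%N := leq_trans jm mn.
pose none k := [set x | ~~ covers Phi x (d k y / delta) && ~~ covers Phi x (d k z / delta)].
(* Earlier centres outside the net and all centres after [j] are unconstrained and contribute a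
   factor 1. *)
pose A k : set R := if (k < j)%N then (if k \in net d delta m then none k else setT)
  else if k == j then cutset (d j y / delta) (d j z / delta) else setT.
have mA k : measurable (A k).
  rewrite /A; case: ifP => _; case: ifP => _ //; first exact: none_measurable.
  exact: cut_measurable.
rewrite (_ : [set w | _] = [set w | forall k, (k < n)%N -> A k (U k w)]); last first.
  apply/seteqP; split=> w /=.
    move=> [cj nk] k kn; rewrite /A; case: ifP => kj.
      by case: ifP => // km; apply: nk.
    by case: eqP => // ->.
  move=> h; split; first by have := h j jln; rewrite /A ltnn eqxx.
  by move=> k km kj; have := h k (ltn_trans kj jln); rewrite /A kj km.
split.
  rewrite (_ : [set w | _] = \bigcap_(k in [set k | (k < n)%N]) [set w | A k (U k w)]).
    by apply: bigcap_measurableType => k _; apply: measurable_coord.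
  by apply/seteqP; split=> w h k; apply: h.
rewrite iid //= (bigID (fun k : 'I_n => (k < j)%N)) /=.
congr (_ * _).
  rewrite -(big_ord_widen_cond n predT (fun k => fine (mu (A k)))) ?(ltnW jln) //.
  apply: eq_bigr => k _; rewrite /A ltn_ord /weight; case: ifP => _.
    by rewrite none_prob.
  by rewrite probability_setT subr0.
rewrite (bigD1 (Ordinal jln)) /= ?ltnn // {1}/A ltnn eqxx big1 ?mulr1 //.
move=> k /andP[kj /eqP kne]; rewrite /A (negPf kj) ifN ?probability_setT //.
by apply/eqP => E; apply: kne; apply: val_inj.
Qed.

Lemma pair_prob j k (A B : set R) : (j < n)%N -> (k < n)%N -> j != k ->
  measurable A -> measurable B ->
  measurable [set w | A (U j w) /\ B (U k w)] /\
  fine (P [set w | A (U j w) /\ B (U k w)]) = fine (mu A) * fine (mu B).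
Proof.
move=> jn kn jk mA mB; split.
  by apply: measurableI; apply: measurable_coord.
pose C i : set R := if i == j then A else if i == k then B else setT.
have mC i : measurable (C i) by rewrite /C; case: eqP => // _; case: eqP.
rewrite (_ : [set w | _] = [set w | forall i, (i < n)%N -> C i (U i w)]); last first.
  apply/seteqP; split=> w /= => [[Aw Bw] i _|h].
    by rewrite /C; case: eqP => [->//|_]; case: eqP => [->//|].
  split; first by have := h j jn; rewrite /C eqxx.
  by have := h k kn; rewrite /C eqxx eq_sym (negPf jk).
rewrite iid //= (bigD1 (Ordinal jn)) //= (bigD1 (Ordinal kn)) /=; last first.
  by apply/eqP => -[] kj; rewrite kj eqxx in jk.
rewrite {1 2}/C !eqxx eq_sym (negPf jk) big1 ?mulr1 //.
move=> i /andP[/eqP ij /eqP ik]; rewrite /C !ifN ?probability_setT //.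
  by apply/eqP => E; apply: ik; apply: val_inj.
by apply/eqP => E; apply: ij; apply: val_inj.
Qed.

Lemma cut_prob_abs s t :
  fine (mu (cutset s t)) = Phi (Num.min s t) - Phi (Num.max s t).
Proof.
have /orP[st|ts] := le_total s t; first by rewrite (min_idPl st) (max_idPr st) cut_prob.
rewrite (min_idPr ts) (max_idPl ts) -cut_prob //; congr (fine (mu _)).
by apply/seteqP; split=> x; rewrite /cutset /= eq_sym.
Qed.

(** Union bound over the first net ball that meets the pair, which is the one that cuts it. *)
Lemma apart_prob_first delta y z : 0 < delta -> (y < m)%N -> (z < m)%N ->
  fine (P [set w | apart Phi N d (U ^~ w) delta m y z]) <=
  cut_bound Phi d delta m y z.
Proof.
move=> delta0 ym zm.
pose A j := if j \in net d delta m then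
  [set w | covers Phi (U j w) (d j y / delta) != covers Phi (U j w) (d j z / delta) /\
     forall k, k \in net d delta m -> (k < j)%N ->
       ~~ covers Phi (U k w) (d k y / delta) && ~~ covers Phi (U k w) (d k z / delta)]
  else set0.
have -> : cut_bound Phi d delta m y z = \sum_(j <- net d delta m) fine (P (A j)).
  apply: eq_big_seq => j jn; rewrite /A jn.
  by have [_ ->] := first_prob y z jn; rewrite cut_prob_abs.
apply: union_bound.
- exact: apart_measurable.
- by move=> j; rewrite /A; case: ifP => // jn; have [] := first_prob y z jn.
move=> w /= /parted_owner /cut_center [j [jn cj h]].
rewrite -bigcup_seq; exists j => //=; rewrite /A jn /=.
by split => // k kn kj; apply: h.
Qed.

(** Separating a close pair takes two cutting centres. In the union bound [q.1.1] cuts the pair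
    itself, while [q.1.2] is a bad centre and [q.2] a close pair that it cuts. Distinct centres are
    independent, hence the product. *)
Lemma apart_prob_close delta y z : 0 < delta -> (y < m)%N -> (z < m)%N ->
  N * d y z <= delta ->
  fine (P [set w | apart Phi N d (U ^~ w) delta m y z]) <=
  \sum_(q : ('I_m * 'I_m) * ('I_m * 'I_m) |
        (q.1.1 != q.1.2) && (N * d q.2.1 q.2.2 <= delta))
    fine (mu (cutset (d q.1.1 y / delta) (d q.1.1 z / delta))) *
    fine (mu (cutset (d q.1.2 q.2.1 / delta) (d q.1.2 q.2.2 / delta))).
Proof.
move=> delta0 ym zm close.
pose A (q : ('I_m * 'I_m) * ('I_m * 'I_m)) :=
  [set w | cutset (d q.1.1 y / delta) (d q.1.1 z / delta) (U q.1.1 w) /\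
    cutset (d q.1.2 q.2.1 / delta) (d q.1.2 q.2.2 / delta) (U q.1.2 w)].
have ltn_mn (i : 'I_m) : (i < n)%N := leq_trans (ltn_ord i) mn.
rewrite (eq_bigr (fun q => fine (P (A q)))); last first.
  move=> q /andP[q1 _].
  have [_ <- //] := pair_prob (ltn_mn q.1.1) (ltn_mn q.1.2) q1
     (cut_measurable Phi (d q.1.1 y / delta) (d q.1.1 z / delta))
     (cut_measurable Phi (d q.1.2 q.2.1 / delta) (d q.1.2 q.2.2 / delta)).
apply: union_bound.
- exact: apart_measurable.
- by move=> q; apply: measurableI; apply: measurable_coord; apply: cut_measurable.
move=> w /= /parted_close.
case=> // [j x||j [k [jm km jk cj /existsP[l /existsP[l' /andP[ll' cl]]]]]].
- exact: (@covers_near R Phi d (U ^~ w)).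
- by move=> j x; apply: (@covers_far R Phi d (U ^~ w)).
rewrite -bigcup_seq_cond; exists ((Ordinal jm, Ordinal km), (l, l')) => //=.
by rewrite mem_index_enum /= jk ll'.
Qed.

Lemma ultra_measurable y z : (y < m)%N -> (z < m)%N -> 0 < d y z ->
  measurable_fun setT (fun w => ultra Phi N d (U ^~ w) m y z).
Proof.
move=> ym zm yz.
have [s [K [s0 _ _ E]]] := ultra_bigmax Phi N_ge1 d_refl d_sym d_tri ym zm yz.
rewrite (funext (fun w => E (U ^~ w))) {E}.
apply: measurable_bigmax => k; apply: measurable_funM; first exact: measurable_cst.
exact/measurable_bool_indic/apart_measurable.
Qed.

(** The cutting rate [beta] at one scale governs the distortion, while the crude Lipschitz constant
    [M] enters the final bound only through [M ^ 2 / N]. *)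
Variables (M beta : R).
Hypothesis M_ge0 : 0 <= M.
Hypothesis Phi_lip : forall s t, s <= t -> Phi s - Phi t <= M * (t - s).

Lemma cut_prob_le delta j y z : 0 < delta ->
  fine (mu (cutset (d j y / delta) (d j z / delta))) <= M * (d y z / delta).
Proof.
move=> delta0; rewrite cut_prob_abs; apply: le_trans (Phi_lip _) _.
  by rewrite ge_min le_max lexx.
apply: ler_wpM2l => //.
have h1 := d_tri j y z; have h2 := d_tri j z y; rewrite (d_sym z y) in h2.
case: (leP (d j y / delta)) => _; rewrite -mulrBl; apply: ler_wpM2r;
  by [rewrite invr_ge0 ltW | lra].
Qed.

Hypothesis near_level : forall delta y z, 0 < delta -> (y < m)%N -> (z < m)%N ->
  cut_bound Phi d delta m y z <= beta * (d y z / delta).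

(** The maximum over scales is bounded by the sum. Each of the at most [a + 4] scales below
    [N * d y z] contributes at most [10 * beta * d y z]. The scales above are controlled by pairs of
    cuts, with [m ^ 4] choices of two centres and a close pair. *)
Lemma expected_ultra y z (a : nat) : (y < m)%N -> (z < m)%N -> 0 < d y z ->
  0 <= beta -> N <= 2 ^+ a ->
  (\int[P]_w (ultra Phi N d (U ^~ w) m y z)%:E <=
   ((10 * beta * (a + 4)%:R + 20 * M ^+ 2 * m%:R ^+ 4 / N) * d y z)%:E)%E.
Proof.
move=> ym zm yz b0 Na; have N0 : 0 < N by apply: lt_le_trans N_ge1.
have [s [K [s0 _ s16 E]]] := ultra_bigmax Phi N_ge1 d_refl d_sym d_tri ym zm yz.
pose ap k w := apart Phi N d (U ^~ w) (s * 2 ^+ k) m y z.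
have sk0 k : 0 < s * 2 ^+ k by rewrite mulr_gt0 // exprn_gt0.
have skw k := ltW (sk0 k); have N0' := ltW N0.
have ck0 k : 0 <= 10 * (s * 2 ^+ k) by rewrite mulr_ge0 // ltW.
have map_ k : measurable [set w | ap k w] by apply: apart_measurable.
apply: le_trans (_ : (\int[P]_w (\sum_(k < K) 10 * (s * 2 ^+ k) * (ap k w)%:R)%:E <= _)%E).
  apply: ge0_le_integral => //.
  - by move=> w _; rewrite lee_fin; apply: ultra_ge0.
  - by apply/measurable_EFinP; apply: ultra_measurable.
  - apply/measurable_EFinP; apply: measurable_sum => k.
    apply: measurable_funM; first exact: measurable_cst.
    exact: measurable_bool_indic.
  - move=> w _; rewrite lee_fin E; apply: bigmax_le => [|k _].
      by apply: sumr_ge0 => k _; rewrite mulr_ge0.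
    by rewrite (bigD1 k) //= lerDl sumr_ge0 // => i _; rewrite mulr_ge0.
rewrite integral_sum_bool // lee_fin.
rewrite (bigID (fun k : 'I_K => N * d y z <= s * 2 ^+ k)) /= addrC mulrDl.
apply: lerD.
  apply: le_trans (_ : \sum_(k < K | (k < a + 4)%N) 10 * beta * d y z <= _).
    apply: le_trans (_ : \sum_(k < K | ~~ (N * d y z <= s * 2 ^+ k)) 10 * beta * d y z <= _).
      apply: ler_sum => k _.
      apply: le_trans (_ : 10 * (s * 2 ^+ k) * (beta * (d y z / (s * 2 ^+ k))) <= _).
        apply: ler_wpM2l => //.
        apply: le_trans (apart_prob_first (sk0 k) ym zm) (near_level (sk0 k) ym zm).
      by have := lt0r_neq0 (sk0 k); move: (s * 2 ^+ k) => t t0; rewrite le_eqVlt; apply/orP; left; apply/eqP; field.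
    rewrite big_mkcond [leRHS]big_mkcond /=; apply: ler_sum => k _.
    case: ifPn => [|_]; last by case: ifP => // _; rewrite !mulr_ge0.
    rewrite -ltNge => h; rewrite ifT //.
    (* The extra 4 comes from [d y z < 16 * s]. *)
    have : s * 2 ^+ k < s * 2 ^+ (a + 4).
      apply: lt_le_trans h _; rewrite exprD mulrCA.
      apply: ler_pM => //.
      by rewrite mulrC; apply: le_trans (ltW s16) _; rewrite -natrX.
    by rewrite ltr_pM2l // ltr_eXn2l // ltr1n.
  have cnt L : \sum_(k < L | (k < a + 4)%N) 10 * beta * d y z =
      10 * beta * d y z * (minn L (a + 4))%:R.
    elim: L => [|L IH]; first by rewrite big_ord0 min0n mulr0.
    rewrite big_mkcond big_ord_recr -big_mkcond /= IH; case: ifP => La.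
      by rewrite (minn_idPl (ltnW La)) (minn_idPl La) -[L.+1%:R]natr1 mulrDr mulr1.
    by rewrite addr0 !(minn_idPr _) //; lia.
  rewrite cnt [leRHS]mulrAC; apply: ler_wpM2l; first by rewrite !mulr_ge0.
  by rewrite ler_nat geq_minr.
pose X := 10 * M ^+ 2 * d y z.
have X0 : 0 <= X by rewrite !mulr_ge0 // exprn_ge0.
apply: le_trans (_ : \sum_(k < K) \sum_(q : ('I_m * 'I_m) * ('I_m * 'I_m))
    (if N * d q.2.1 q.2.2 <= s * 2 ^+ k
     then X / N * (N * d q.2.1 q.2.2 / (s * 2 ^+ k)) else 0) <= _).
  rewrite big_mkcond /=; apply: ler_sum => k _; case: ifPn => [close|_]; last first.
    apply: sumr_ge0 => q _; case: ifP => // _.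
    by apply: mulr_ge0; apply: divr_ge0 => //; apply: mulr_ge0.
  apply: le_trans (ler_wpM2l (ck0 k) (apart_prob_close (sk0 k) ym zm close)) _.
  rewrite big_mkcond mulr_sumr; apply: ler_sum => q _.
  case: ifPn => [/andP[_ ->]|_]; last first.
    rewrite mulr0; case: ifP => // _.
    by apply: mulr_ge0; apply: divr_ge0 => //; apply: mulr_ge0.
  apply: le_trans (_ : 10 * (s * 2 ^+ k) * ((M * (d y z / (s * 2 ^+ k))) *
      (M * (d q.2.1 q.2.2 / (s * 2 ^+ k)))) <= _).
    apply: ler_wpM2l => //; apply: ler_pM; rewrite ?cut_prob_le //.
      by rewrite cut_prob_abs subr_ge0; apply: Phi_anti; rewrite ge_min !le_max !lexx.
    by rewrite cut_prob_abs subr_ge0; apply: Phi_anti; rewrite ge_min !le_max !lexx.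
  have := lt0r_neq0 (sk0 k); have := lt0r_neq0 N0; move: (s * 2 ^+ k) => t h1 h2.
  by rewrite /X le_eqVlt; apply/orP; left; apply/eqP; field; rewrite h1 h2.
(* For a fixed [q] the closeness condition makes the sum over all scales a geometric tail, so the
   number of scales does not enter. *)
rewrite exchange_big /=.
apply: le_trans (_ : \sum_(q : ('I_m * 'I_m) * ('I_m * 'I_m)) (X / N * 2) <= _).
  apply: ler_sum => q _; rewrite -big_mkcond -mulr_sumr; apply: ler_wpM2l.
    by rewrite divr_ge0 // ltW.
  by apply: geometric_tail => //; rewrite mulr_ge0 // ltW.
rewrite sumr_const !card_prod !card_ord -[_ *+ (m * m * (m * m))]mulr_natr !natrM /X le_eqVlt.
by apply/orP; left; apply/eqP; have h := lt0r_neq0 N0; field.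
Qed.

End Expectation.

Close Scope classical_set_scope.

(** * Cut probability at one scale *)

Lemma sum_net_le (R : realType) (d : nat -> nat -> R) (delta : R) (m : nat)
    (F : nat -> R) : (forall j, 0 <= F j) ->
  \sum_(j <- net d delta m) F j <= \sum_(j < m) F j.
Proof.
move=> F0; elim: m => [|m IH] /=; first by rewrite big_nil big_ord0.
rewrite big_ord_recr /=; case: ifP => _; last by rewrite -[leLHS]addr0 lerD.
by rewrite -cats1 big_cat big_seq1 lerD2r.
Qed.

(** The terms are the probabilities of a first success at trial [j] among independent trials, and
    they telescope. *)
Lemma sum_first_le1 (R : realType) (w : nat -> R) (m : nat) :
  (forall k, 0 <= w k <= 1) ->
  \sum_(j < m) (\prod_(k < j) (1 - w k)) * w j <= 1.
Proof.
move=> w01; have -> : \sum_(j < m) (\prod_(k < j) (1 - w k)) * w j =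
    1 - \prod_(k < m) (1 - w k).
  elim: m => [|m IH]; first by rewrite !big_ord0 subrr.
  by rewrite big_ord_recr /= IH [in RHS]big_ord_recr /=; ring.
rewrite lerBlDr lerDl; apply: prodr_ge0 => k _.
by have := w01 k; lra.
Qed.

Section CutBound.
Variables (R : realType) (Phi : R -> R) (d : nat -> nat -> R).
Hypothesis Phi01 : forall t, 0 <= Phi t <= 1.
Hypothesis Phi_anti : forall s t, s <= t -> Phi t <= Phi s.
Hypothesis d_refl : forall k, d k k = 0.
Hypothesis d_sym : forall j k, d j k = d k j.
Hypothesis d_tri : forall i j k, d i k <= d i j + d j k.

Let d0 j k : 0 <= d j k := d_ge0 d_refl d_sym d_tri j k.

Let gap delta j y z : 0 < delta ->
  Num.max (d j y / delta) (d j z / delta) - Num.min (d j y / delta) (d j z / delta)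
    <= d y z / delta.
Proof.
move=> delta0; have h1 := d_tri j y z; have h2 := d_tri j z y.
rewrite (d_sym z y) in h2.
case: (leP (d j y / delta)) => _; rewrite -mulrBl; apply: ler_wpM2r;
  by [rewrite invr_ge0 ltW | lra].
Qed.

Let first01 delta m y z (j : nat) :
  0 <= \prod_(k < j) (1 - (if (k : nat) \in net d delta m
     then Phi (Num.min (d k y / delta) (d k z / delta)) else 0)) <= 1.
Proof.
apply/andP; split; [apply: prodr_ge0 | apply: prodr_ile1] => k _;
  have := Phi01 (Num.min (d k y / delta) (d k z / delta)); case: ifP; lra.
Qed.

(* Exponential decay is memoryless, so the sum telescopes up to the truncation
   error eps. *)
Lemma cut_bound_exp (kappa eps delta : R) (m y z : nat) :
  0 <= kappa -> 0 <= eps -> 0 < delta ->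
  (forall s t, s <= t -> Phi s - Phi t <= kappa * (t - s) * (Phi s + eps)) ->
  cut_bound Phi d delta m y z <= kappa * (1 + m%:R * eps) * (d y z / delta).
Proof.
move=> k0 e0 delta0 Phi_exp; rewrite /cut_bound.
pose w k := if k \in net d delta m
  then Phi (Num.min (d k y / delta) (d k z / delta)) else 0.
have w01 k : 0 <= w k <= 1 by rewrite /w; case: ifP => // _; rewrite lexx ler01.
have eta0 : 0 <= d y z / delta by rewrite divr_ge0 // ltW.
pose F j := (\prod_(k < j) (1 - w k)) * (kappa * (d y z / delta) * (w j + eps)).
have F0 j : 0 <= F j.
  have /andP[p0 _] := first01 delta m y z j; have /andP[w0 _] := w01 j.
  by apply: mulr_ge0 => //; apply: mulr_ge0; [apply: mulr_ge0 | apply: addr_ge0].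
apply: le_trans (_ : \sum_(j <- net d delta m) F j <= _).
  rewrite big_seq [leRHS]big_seq; apply: ler_sum => j jn.
  have /andP[p0 _] := first01 delta m y z j.
  apply: ler_wpM2l => //; rewrite /w jn.
  set s := Num.min _ _; set t := Num.max _ _.
  have st : s <= t by rewrite /s /t ge_min le_max lexx.
  apply: le_trans (Phi_exp _ _ st) _; apply: ler_wpM2r.
    by rewrite addr_ge0 //; have /andP[] := Phi01 s.
  by apply: ler_wpM2l => //; apply: gap.
apply: le_trans (sum_net_le _ _ _ F0) _.
(* The part with [w j] is a first-success sum, at most 1. The truncation error [eps] is paid once
   per point. *)
have -> : \sum_(j < m) F j = kappa * (d y z / delta) *
    (\sum_(j < m) (\prod_(k < j) (1 - w k)) * w j + eps * \sum_(j < m) \prod_(k < j) (1 - w k)).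
  by rewrite [eps * _]mulr_sumr -big_split mulr_sumr; apply: eq_bigr => j _; rewrite /F /=; ring.
rewrite [leRHS]mulrAC; apply: ler_wpM2l; first exact: mulr_ge0.
apply: lerD; first exact: sum_first_le1.
rewrite mulrC; apply: ler_wpM2r => //.
apply: le_trans (_ : \sum_(j < m) 1 <= _); last by rewrite sumr_const card_ord.
by apply: ler_sum => j _; have /andP[] := first01 delta m y z j.
Qed.

(** Only net points within [delta / 2] of [y] or [z] can cut the pair, and there are at most [2 * K]
    of them. *)
Lemma cut_bound_packing (M delta : R) (m y z K : nat) :
  0 <= M -> 0 < delta ->
  (forall s t, s <= t -> Phi s - Phi t <= M * (t - s)) ->
  (forall t, 2^-1 < t -> Phi t = 0) ->
  (forall x, (x < m)%N -> (count (fun j => (d j x <= delta / 2)%R) (net d delta m) <= K)%N) ->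
  (y < m)%N -> (z < m)%N ->
  cut_bound Phi d delta m y z <= M * (2 * K%:R) * (d y z / delta).
Proof.
move=> M0 delta0 Phi_lip Phi_far pack ym zm; rewrite /cut_bound.
have eta0 : 0 <= d y z / delta by rewrite divr_ge0 // ltW.
pose F j := M * (d y z / delta) *
  ((d j y <= delta / 2)%R%:R + (d j z <= delta / 2)%R%:R).
apply: le_trans (_ : \sum_(j <- net d delta m) F j <= _).
  apply: ler_sum => j _.
  have /andP[p0 p1] := first01 delta m y z j.
  set s := Num.min _ _; set t := Num.max _ _.
  have st : s <= t by rewrite /s /t ge_min le_max lexx.
  apply: le_trans (_ : Phi s - Phi t <= _).
    by apply: ler_piMl => //; rewrite subr_ge0; apply: Phi_anti.
  have h : Phi s - Phi t <= M * (d y z / delta).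
    by apply: le_trans (Phi_lip _ _ st) _; apply: ler_wpM2l => //; apply: gap.
  rewrite /F; case: (leP (d j y) (delta / 2)) => h1;
    case: (leP (d j z) (delta / 2)) => h2 /=; first by rewrite mulrDr mulr1; apply: ler_wpDr => //; apply: mulr_ge0.
  - by rewrite addr0 mulr1.
  - by rewrite add0r mulr1.
  rewrite addr0 mulr0 (Phi_far s) ?(Phi_far t) ?subrr //.
    by rewrite /t lt_max ltr_pdivlMr // mulrC h1.
  by rewrite /s lt_min !ltr_pdivlMr // mulrC h1 h2.
rewrite -mulr_sumr [leRHS]mulrAC; apply: ler_wpM2l; first exact: mulr_ge0.
have cnt x : (x < m)%N ->
    \sum_(j <- net d delta m) ((d j x <= delta / 2)%R%:R : R) <= K%:R.
  move=> xm; rewrite -natr_sum ler_nat; apply: leq_trans (pack x xm).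
  by rewrite -sum1_count [leqRHS]big_mkcond; apply: leq_sum => j _; case: ifP.
by rewrite big_split /=; have := cnt y ym; have := cnt z zm; lra.
Qed.

End CutBound.

(** * Linear and exponential tails of the radius *)

Definition clip (R : realType) (t : R) : R :=
  if t <= 4^-1 then 4^-1 else if t <= 2^-1 then t else 2^-1.

Lemma clip_in (R : realType) (t : R) : 4^-1 <= clip t <= 2^-1.
Proof. by rewrite /clip; case: (leP t 4^-1) => ?; case: (leP t 2^-1) => ?; lra. Qed.

Lemma clip_lip (R : realType) (s t : R) : s <= t -> 0 <= clip t - clip s <= t - s.
Proof.
rewrite /clip => st; case: (leP t 4^-1) => ?; case: (leP t 2^-1) => ?;
  by case: (leP s 4^-1) => ?; case: (leP s 2^-1) => ?; lra.
Qed.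

Lemma clip_near (R : realType) (t : R) : t <= 4^-1 -> clip t = 4^-1.
Proof. by rewrite /clip => ->. Qed.

Lemma clip_far (R : realType) (t : R) : 2^-1 < t -> clip t = 2^-1.
Proof. by rewrite /clip => h; rewrite !ifN // -ltNge //; lra. Qed.

(** The tail of the uniform distribution on [[1/4, 1/2]]. *)
Definition linear_cover (R : realType) (t : R) : R := 2 - 4 * clip t.

Lemma linear_coverP (R : realType) (Phi := @linear_cover R) :
  [/\ forall t, 0 <= Phi t <= 1,
      forall s t, s <= t -> Phi t <= Phi s,
      forall t, t <= 4^-1 -> Phi t = 1,
      forall t, 2^-1 < t -> Phi t = 0 &
      forall s t, s <= t -> Phi s - Phi t <= 4 * (t - s)].
Proof.
rewrite /Phi /linear_cover; split=> [t|s t st|t h|t h|s t st].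
- by have := clip_in t; lra.
- by have := clip_lip st; lra.
- by rewrite clip_near //; lra.
- by rewrite clip_far //; lra.
- by have := clip_lip st; lra.
Qed.

(** The tail of an exponential variable of rate [4 * L] started at [1/4] and conditioned to stay
    below [1/2]. *)
Definition exp_cover (R : realType) (L t : R) : R :=
  (expR (- (4 * L * (clip t - 4^-1))) - expR (- L)) /
  (1 - expR (- L)).

(** Adding [eps] undoes the truncation: [Phi + eps] is a pure exponential on the range of [clip],
    and [1 - exp (- x) <= x] gives the relative decay. *)
Lemma exp_coverP (R : realType) (L : R) (Phi := exp_cover L)
    (eps := expR (- L) / (1 - expR (- L))) : 0 < L ->
  [/\ forall t, 0 <= Phi t <= 1,
      forall s t, s <= t -> Phi t <= Phi s,
      forall t, t <= 4^-1 -> Phi t = 1,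
      forall t, 2^-1 < t -> Phi t = 0 &
      forall s t, s <= t -> Phi s - Phi t <= 4 * L * (t - s) * (Phi s + eps)].
Proof.
move=> L0; pose q := 1 - expR (- L).
have q0 : 0 < q by rewrite subr_gt0 expR_lt1 oppr_lt0.
have anti s t : s <= t -> Phi t <= Phi s.
  move=> /clip_lip /andP[st _]; rewrite ler_pM2r ?invr_gt0 // lerD2r ler_expR lerN2.
  by apply: ler_wpM2l; [rewrite mulr_ge0 // ltW | rewrite lerD2r -subr_ge0].
have near t : t <= 4^-1 -> Phi t = 1.
  move=> h; rewrite /Phi /exp_cover clip_near //.
  by rewrite subrr mulr0 oppr0 expR0 divff // gt_eqF.
have far t : 2^-1 < t -> Phi t = 0.
  move=> h; rewrite /Phi /exp_cover clip_far //.
  by rewrite (_ : 4 * L * _ = L) ?subrr ?mul0r //; field.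
split=> // [t|s t st].
  have /orP[h|h] := le_total t 4^-1; first by rewrite near // ler01 lexx.
  rewrite -[X in _ && (_ <= X)](near 4^-1) // anti // andbT.
  have /orP[h'|h'] := le_total t 1; last by rewrite far //; lra.
  by rewrite -(far 1) ?anti //; lra.
have /andP[st0 st1] := clip_lip st.
have E u : Phi u + eps = expR (- (4 * L * (clip u - 4^-1))) / q.
  by rewrite /Phi /exp_cover /eps -/q -mulrDl subrK.
have -> : Phi s - Phi t = (Phi s + eps) - (Phi t + eps) by ring.
set a := 4 * L * (clip s - 4^-1); set b := 4 * L * (clip t - 4^-1).
have ab : expR (- a) - expR (- b) <= (b - a) * expR (- a).
  have -> : expR (- b) = expR (- a) * expR (- (b - a)).
    by rewrite -expRD; congr expR; ring.
  have := expR_ge1Dx (- (b - a)); have := expR_gt0 (- a); nra.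
rewrite !E -mulrBl mulrA; apply: ler_wpM2r; first by rewrite invr_ge0 ltW.
apply: le_trans ab _; apply: ler_wpM2r; first exact: expR_ge0.
rewrite (_ : b - a = 4 * L * (clip t - clip s)); last by rewrite /a /b; ring.
by apply: ler_wpM2l => //; rewrite mulr_ge0 // ltW.
Qed.

(** * Packing in normed spaces *)

(* A barycentric spanner: the rows maximizing |det| express every other row
   with coefficients in [-1, 1], by Cramer's rule. *)
Lemma barycentric_spanner (R : realType) (D r : nat) (q : 'I_r -> 'rV[R]_D)
    (f0 : {ffun 'I_D -> 'I_r}) :
  \det (\matrix_(k < D) q (f0 k)) != 0 ->
  exists f : {ffun 'I_D -> 'I_r}, forall l, exists a : 'rV[R]_D,
    (forall k, `|a 0 k| <= 1) /\ q l = \sum_k a 0 k *: q (f k).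
Proof.
move=> f0_free; pose A (f : {ffun 'I_D -> 'I_r}) := \matrix_(k < D) q (f k).
have [f _ fmax] := Order.TotalTheory.arg_maxP (fun f => `|\det (A f)|) (erefl : xpredT f0).
have detA : 0 < `|\det (A f)|.
  by apply: lt_le_trans (fmax f0 isT); rewrite normr_gt0.
have unitA : A f \in unitmx by rewrite unitmxE unitfE -normr_gt0.
exists f => l; exists (q l *m invmx (A f)); split=> [k|]; last first.
  rewrite -[LHS](mulmxKV unitA) mulmx_sum_row.
  by apply: eq_bigr => k _; rewrite rowK.
(* Replacing row [k] by [q l] leaves the cofactors along that row unchanged, so the coefficient is a
   quotient of determinants. *)
pose g : {ffun 'I_D -> 'I_r} := [ffun i => if i == k then l else f i].
have cof j : cofactor (A g) k j = cofactor (A f) k j.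
  rewrite /cofactor; congr (_ * \det _); apply/matrixP => i i'.
  by rewrite !mxE ffunE eq_sym (negPf (neq_lift k i)).
have -> : (q l *m invmx (A f)) 0 k = \det (A g) / \det (A f).
  rewrite /invmx unitA -scalemxAr mxE mulrC; congr (_ / _).
  rewrite (expand_det_row _ k) mxE; apply: eq_bigr => j _.
  by rewrite cof !mxE ffunE eqxx.
by rewrite normrM normfV ler_pdivrMr // mul1r; apply: fmax.
Qed.

Lemma norm_sum_le (R : realType) (D r : nat) (Nm : 'rV[R]_D -> R)
    (a : 'I_r -> R) (b : 'I_r -> 'rV[R]_D) : is_norm Nm ->
  (forall k, Nm (b k) <= 1) -> Nm (\sum_k a k *: b k) <= \sum_k `|a k|.
Proof.
move=> [N0 [_ [NZ ND]]] b1; elim/big_rec2: _ => [|k x y _ h].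
  by rewrite -[X in Nm X](scale0r 0) NZ normr0 mul0r.
apply: le_trans (ND _ _) _; apply: lerD => //.
by rewrite NZ ler_piMr.
Qed.

(** Coefficients over a spanner of norm at most 1 lie in [[-1, 1]]. Cutting that cube into cells of
    side [1 / (2 * D)] separates the points, because two points of one cell are at distance at most
    [D / (2 * D)]. *)
Lemma norm_packing (R : realType) (D m : nat) (Nm : 'rV[R]_D -> R)
    (p : 'I_m -> 'rV[R]_D) : is_norm Nm ->
  (forall i, Nm (p i) <= 1) -> (forall i j, i != j -> 2^-1 < Nm (p i - p j)) ->
  (m <= (4 * D).+1 ^ D)%N.
Proof.
move=> normN p1 far; have [N0 [_ [NZ ND]]] := normN.
pose eps := (1 + \sum_(k < D) Nm (delta_mx 0 k))^-1.
have S0 : 0 <= \sum_(k < D) Nm (delta_mx 0 k) by apply: sumr_ge0.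
have eps0 : 0 < eps by rewrite invr_gt0; lra.
(* Short multiples of the standard basis are added, so that the family spans even when the points do
   not. *)
pose q (i : 'I_(m + D)) := match fintype.split i with
  | inl i => p i | inr k => eps *: delta_mx 0 k end.
have q1 i : Nm (q i) <= 1.
  rewrite /q; case: (fintype.split i) => // k; rewrite NZ gtr0_norm // /eps mulrC ler_pdivrMr; last by lra.
  rewrite mul1r (bigD1 k) //=.
  have : 0 <= \sum_(i < D | i != k) Nm (delta_mx 0 i) by apply: sumr_ge0.
  by lra.
have [|f span] := @barycentric_spanner R D _ q [ffun k => rshift m k].
  rewrite (_ : \matrix_k _ = eps%:M).
    by rewrite det_scalar expf_neq0 // gt_eqF.
  apply/matrixP => i j; rewrite !mxE ffunE /q; case: split_ordP => k.
    by move/eqP; rewrite eq_rlshift.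
  by move/rshift_inj => <-; rewrite !mxE /= eq_sym mulr_natr.
have {span} [a aP] := choice (fun i : 'I_m => span (lshift D i)).
pose x i k := (a i 0 k + 1) * (2 * D%:R).
have x0 i k : 0 <= x i k.
  by have [/(_ k)] := aP i; rewrite ler_norml => /andP[? _] _; apply: mulr_ge0; [lra|apply: mulr_ge0].
(* The rescaled coefficients lie in [[0, 4 * D]], so their integer parts take [4 * D + 1] values. *)
pose cell i : {ffun 'I_D -> 'I_(4 * D).+1} := [ffun k => inord (Num.truncn (x i k))].
have cellE i k : (Num.truncn (x i k) < (4 * D).+1)%N.
  rewrite -(ltr_nat R); have /andP[h _] := truncn_itv (x0 i k).
  apply: le_lt_trans h _; rewrite -natr1 natrM.
  have [/(_ k)] := aP i; rewrite ler_norml => /andP[_ a1] _.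
  have : 0 <= D%:R :> R by []. 
  by rewrite /x; nra.
suff inj : injective cell.
  by have := leq_card cell inj; rewrite card_ffun !card_ord.
move=> i j E; apply/eqP; apply: contraT => ij; have := far _ _ ij.
have close k : `|a i 0 k - a j 0 k| * (2 * D%:R) <= 1.
  have : Num.truncn (x i k) = Num.truncn (x j k).
    have := congr1 (fun c : {ffun 'I_D -> 'I_(4 * D).+1} => val (c k)) E.
    by rewrite !ffunE /= !inordK.
  move=> tij; have := truncn_itv (x0 i k); have := truncn_itv (x0 j k); rewrite tij.
  rewrite -natr1 => /andP[h1 h2] /andP[h3 h4].
  have D0 : 0 <= 2 * D%:R :> R by apply: mulr_ge0.
  rewrite -[X in _ * X]ger0_norm // -normrM ler_norml.
  have -> : (a i 0 k - a j 0 k) * (2 * D%:R) = x i k - x j k by rewrite /x; ring.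
  by apply/andP; split; lra.
have qE l : p l = q (lshift D l).
  by rewrite /q; case: split_ordP => [l' /lshift_inj -> // | k /eqP]; rewrite eq_lrshift.
have -> : p i - p j = \sum_k (a i 0 k - a j 0 k) *: q (f k).
  rewrite !qE (aP i).2 (aP j).2 -sumrB.
  by apply: eq_bigr => k _; rewrite scalerBl.
move=> h; have := lt_le_trans h (norm_sum_le _ normN (fun k => q1 (f k))).
rewrite ltNge => /negP; case.
case: (posnP D) => [D0|D0].
  by rewrite big1 ?invr_ge0 // => k; have := ltn_ord k; rewrite [X in (_ < X)%N]D0.
have D1 : 0 < 2 * D%:R :> R by rewrite mulr_gt0 // ltr0n.
apply: le_trans (_ : \sum_(k < D) (2 * D%:R)^-1 <= _).
  by apply: ler_sum => k _; rewrite -[leRHS]mul1r ler_pdivlMr.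
rewrite sumr_const card_ord -[_ *+ D]mulr_natr invfM -mulrA mulVf ?mulr1 //.
by rewrite pnatr_eq0 -lt0n.
Qed.

(** * The online embedding *)

Lemma norm_metric (R : realType) (D : nat) (Nm : 'rV[R]_D -> R) :
  is_norm Nm -> is_metric (fun x y => Nm (x - y)).
Proof.
move=> [N0 [Ndef [NZ ND]]]; split; first by move=> x y.
split.
  move=> x y; split=> [/Ndef/eqP|->]; first by rewrite subr_eq0 => /eqP.
  by rewrite subrr -[X in Nm X](scale0r 0) NZ normr0 mul0r.
split=> [x y|x y z]; last by rewrite -[x - z](subrKA y).
by rewrite -(opprB y) -scaleN1r NZ normrN1 mul1r.
Qed.

(** Rescaled by [2 / delta], these net points lie in a unit ball, and their separation [delta / 4]
    becomes [1/2]. *)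
Lemma net_packing (R : realType) (D : nat) (Nm : 'rV[R]_D -> R)
    (x : nat -> 'rV[R]_D) (delta : R) (m : nat) (c : 'rV[R]_D)
    (d := fun j k => Nm (x j - x k)) : is_norm Nm -> 0 < delta ->
  (count (fun j => (Nm (x j - c) <= delta / 2)%R) (net d delta m) <= (4 * D).+1 ^ D)%N.
Proof.
move=> normN delta0; have [_ [_ [NZ _]]] := normN.
have [_ [_ [dsym _]]] := norm_metric normN.
rewrite -size_filter; set s := seq.filter _ _.
have s_uniq : uniq s by rewrite filter_uniq // net_uniq.
have delta2 : 0 < 2 / delta by rewrite divr_gt0.
have sP (i : 'I_(size s)) : nth 0%N s i \in s by rewrite mem_nth.
apply: (@norm_packing R D (size s) Nm (fun i => (2 / delta) *: (x (nth 0%N s i) - c))) => //.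
  move=> i; rewrite NZ gtr0_norm //.
  have := sP i; rewrite mem_filter => /andP[h _].
  rewrite mulrAC ler_pdivrMr // mul1r; lra.
move=> i j ij; rewrite -scalerBr NZ gtr0_norm // opprB addrA subrK.
wlog lt_ij : i j ij / (nth 0%N s i < nth 0%N s j)%N.
  move=> W; have [h|h|/eqP] := ltngtP (nth 0%N s i) (nth 0%N s j).
  - exact: W.
  - by rewrite dsym; apply: W => //; rewrite eq_sym.
  - by rewrite nth_uniq // => /eqP/val_inj E; rewrite E eqxx in ij.
have := sP i; have := sP j; rewrite !mem_filter => /andP[_ hj] /andP[_ hi].
have := net_far hi hj lt_ij; rewrite /d => h.
rewrite mulrAC ltr_pdivlMr //; lra.
Qed.

Lemma alive_seen (X : choiceType) (s : seq (update X)) (x : X) :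
  alive s x -> x \in map fst s.
Proof.
rewrite /alive; elim/last_ind: s => // s p IH.
rewrite foldl_rcons map_rcons mem_rcons inE; case: p.2.
  by case=> [/IH ->|/= ->]; rewrite ?orbT ?eqxx.
by case=> /IH ->; rewrite orbT.
Qed.

(** Departures are ignored: each update occupies an index, a point is represented by its first
    occurrence, and the output is restricted to the alive set. Repeated points are why [dist] is
    only a pseudometric. *)
Lemma embedding_exists (R : realType) (X : choiceType) (dX : X -> X -> R)
    (x0 : X) (n a : nat) (Phi : R -> R) (N M beta lam : R) :
  is_metric dX ->
  (forall t, 0 <= Phi t <= 1) ->
  (forall s t, s <= t -> Phi t <= Phi s) ->
  (forall t, t <= 4^-1 -> Phi t = 1) ->
  (forall t, 2^-1 < t -> Phi t = 0) ->
  0 <= M -> (forall s t, s <= t -> Phi s - Phi t <= M * (t - s)) ->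
  1 <= N -> N <= 2 ^+ a -> 0 <= beta ->
  (forall (x : nat -> X) m delta y z, (1 < m)%N -> (m <= n)%N -> 0 < delta ->
     (y < m)%N -> (z < m)%N ->
     cut_bound Phi (fun j k => dX (x j) (x k)) delta m y z <=
       beta * (dX (x y) (x z) / delta)) ->
  ((1 < n)%N -> 10 * beta * (a + 4)%:R + 20 * M ^+ 2 * n%:R ^+ 4 / N <= lam) ->
  prob_online_monotone_emb_HST dX n lam.
Proof.
move=> [d0 [deq0 [dsym dtri]]] Phi01 Phi_anti Phi_near Phi_far M0 Phi_lip
  N1 Na beta0 near lam_ge.
have [dd [Omega [P [U [mU iid]]]]] := iid_family (uniform_prob (@ltr01 R)) n.
pose dist xs j k := dX (nth x0 xs j) (nth x0 xs k).
have dist_refl xs k : dist xs k k = 0 by apply/deq0.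
have dist_sym xs j k : dist xs j k = dist xs k j by apply: dsym.
have dist_tri xs i j k : dist xs i k <= dist xs i j + dist xs j k by apply: dtri.
pose e w (s : seq (update X)) u v : R := let xs := map fst s in
  if (u \in xs) && (v \in xs)
  then ultra Phi N (dist xs) (U ^~ w) (size xs) (index u xs) (index v xs) else 0.
have eE w s u v : alive s u -> alive s v -> e w s u v =
    ultra Phi N (dist (map fst s)) (U ^~ w) (size (map fst s))
      (index u (map fst s)) (index v (map fst s)).
  by move=> /alive_seen us /alive_seen vs; rewrite /e us vs.
have idx (s : seq (update X)) u : alive s u -> (index u (map fst s) < size (map fst s))%N.
  by move=> /alive_seen; rewrite index_mem.
have dist_idx (s : seq (update X)) u v : alive s u -> alive s v ->
    dist (map fst s) (index u (map fst s)) (index v (map fst s)) = dX u v.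
  by move=> /alive_seen us /alive_seen vs; rewrite /dist !nth_index.
have e_refl w s u : e w s u u = 0 by rewrite /e; case: ifP => // _; rewrite ultra_refl.
have e_dom w s u v : alive s u -> alive s v -> dX u v <= e w s u v.
  by move=> us vs; rewrite eE // -(dist_idx s) //; apply: ultra_dominates => //; apply: idx.
have m_le (s : seq (update X)) : (size s <= n)%N -> (size (map fst s) <= n)%N.
  by rewrite size_map.
exists dd, Omega, P, e; split; last split.
- move=> w s sn; split.
    apply: (@finite_ultrametric_HST R X (map fst s)).
    + exact: alive_seen.
    + by move=> x y sx sy; rewrite eE //; apply: ultra_ge0 => //; apply: idx.
    + move=> x y sx sy; split=> [exy|->]; last exact: e_refl.
      apply/deq0/le_anti; rewrite d0 andbT -exy; exact: e_dom.
    + by move=> x y sx sy; rewrite !eE // ultra_sym.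
    + by move=> x y z sx sy sz; rewrite !eE //; apply: ultra_max => //; apply: idx.
  split; first by move=> u v; apply: e_dom.
  move=> s' x -> u v us' us vs' vs; rewrite !eE //.
  have [us1 vs1] := (alive_seen us', alive_seen vs').
  have [ui vi] := (idx _ _ us', idx _ _ vs').
  rewrite !map_rcons size_rcons -!cats1 !index_cat us1 vs1.
  (* The last update adds one index and leaves all earlier indices and their distances unchanged. *)
  apply: le_trans (ultra_step _ _ _ _ _ _ ui vi) _ => //.
  rewrite le_eqVlt; apply/orP; left; apply/eqP; apply: eq_ultra => // j k jm km.
  by rewrite /dist !nth_cat jm km.
- move=> s sn u v; rewrite /e /=;
  case: (boolP ((u \in map fst s) && (v \in map fst s))) => [/andP[us vs]|_];
  last exact: measurable_cst.
  have [<-|uv] := eqVneq u v.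
    rewrite [X in measurable_fun _ X](_ : _ = cst 0); first exact: measurable_cst.
    by apply/funext => w; rewrite ultra_refl.
  apply: (ultra_measurable Phi mU N1 (dist_refl _) (dist_sym _) (dist_tri _)); rewrite ?index_mem // /dist !nth_index //.
  by rewrite lt_neqAle d0 andbT eq_sym; apply/eqP => /deq0 E; rewrite E eqxx in uv.
- move=> s sn u v us vs; have [<-|uv] := eqVneq u v.
    rewrite (_ : dX u u = 0) ?mulr0; last exact/deq0.
    by under eq_integral do rewrite e_refl; rewrite integral0.
  have duv : 0 < dX u v by rewrite lt_neqAle d0 andbT eq_sym; apply/eqP => /deq0 E; rewrite E eqxx in uv.
  under eq_integral do rewrite eE //.
  (* Two distinct alive points need two updates, so the hypotheses stated for [1 < m] and [1 < n]
     apply. *)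
  have m2 : (1 < size (map fst s))%N.
    rewrite ltnNge; apply: contra uv => m1.
    have := idx _ _ us; have := idx _ _ vs => iv iu; apply/eqP.
    rewrite -(nth_index x0 (alive_seen us)) -(nth_index x0 (alive_seen vs)).
    by congr nth; lia.
  have mn := m_le _ sn.
  apply: le_trans (expected_ultra Phi01 Phi_anti Phi_near Phi_far mU iid N1 mn
    (dist_refl _) (dist_sym _) (dist_tri _) M0 Phi_lip (beta := beta) _
    (idx _ _ us) (idx _ _ vs) _ beta0 Na) _.
  + by move=> delta y z delta0 ym zm; apply: near.
  + by rewrite dist_idx.
  rewrite dist_idx // lee_fin; apply: ler_wpM2r; first exact: d0.
  apply: le_trans (lam_ge (leq_trans m2 mn)); rewrite lerD2l.
  apply: ler_wpM2r; first by rewrite invr_ge0; lra.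
  apply: ler_wpM2l; first by rewrite mulr_ge0 // exprn_ge0.
  by rewrite lerXn2r ?nnegrE // ler_nat.
Qed.

Lemma embedding_empty (R : realType) (X : Type) (dX : X -> X -> R) (n : nat) (lam : R) :
  (X -> False) -> prob_online_monotone_emb_HST dX n lam.
Proof.
move=> X0; exists _, _, (uniform_prob (@ltr01 R)), (fun _ _ _ _ => 0).
split; last by split=> [s _ u|s _ u]; case: (X0 u).
move=> w s _; split; last by split=> [u|s' x _ u]; case: (X0 u).
by left; apply/seteqP; split=> u; case: (X0 u).
Qed.

(** * Distortion *)

Lemma up_log_ln (R : realType) (n : nat) : (1 < n)%N ->
  (up_log 2 n)%:R * ln 2 <= 2 * ln n%:R :> R.
Proof.
move=> n1; have /andP[l1 _] := up_log_bounds (erefl : 1 < 2)%N n1.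
have n2 : ln 2 <= ln n%:R :> R by rewrite ler_ln ?posrE ?ltr0n ?ler_nat // ltnW.
have : (2 ^+ (up_log 2 n).-1 : R) <= n%:R by rewrite -natrX ler_nat ltnW.
rewrite -ler_ln ?posrE ?exprn_gt0 ?ltr0n //; last exact: ltnW.
rewrite lnXn // -[ln 2 *+ _]mulr_natl => h.
have -> : (up_log 2 n)%:R = (up_log 2 n).-1%:R + 1 :> R.
  by rewrite natr1 prednK // up_log_gt0 // n1.
by rewrite mulrDl mul1r; lra.
Qed.

Lemma ln2_gt0 (R : realType) : 0 < ln 2 :> R.
Proof. by rewrite ln_gt0 // ltr1n. Qed.

(** The exponent [6 * up_log 2 n] is the [a] with [n ^ 6 <= 2 ^ a]. *)
Lemma level_count (R : realType) (n : nat) : (1 < n)%N ->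
  (6 * up_log 2 n + 4)%:R <= 20 * ln n%:R / ln 2 :> R.
Proof.
move=> n1; rewrite ler_pdivlMr ?ln2_gt0 //.
have l1 : (1 <= up_log 2 n)%N by rewrite up_log_gt0.
apply: le_trans (_ : (10 * up_log 2 n)%:R * ln 2 <= _).
  by apply: ler_wpM2r; [exact/ltW/ln2_gt0 | rewrite ler_nat; lia].
by have := up_log_ln R n1; rewrite natrM; lra.
Qed.

Lemma pow6_le (R : realType) (n : nat) : (n%:R ^+ 6 : R) <= 2 ^+ (6 * up_log 2 n).
Proof.
rewrite mulnC exprM lerXn2r ?nnegrE ?exprn_ge0 // -natrX ler_nat.
exact: up_logP.
Qed.

Lemma ln_le_nat (R : realType) (n : nat) : (0 < n)%N -> ln n%:R <= n%:R :> R.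
Proof.
move=> n0; have h : 0 < n%:R :> R by rewrite ltr0n.
by have := expR_ge1Dx (ln (n%:R : R)); rewrite lnK ?posrE //; lra.
Qed.

(** At most one point is alive, so every [lam] is admissible, in particular the bound 0 that [ln]
    gives for [n] equal to 0 or 1. *)
Lemma embedding_trivial (R : realType) (X : choiceType) (dX : X -> X -> R)
    (x0 : X) (n : nat) (lam : R) : is_metric dX -> (n <= 1)%N ->
  prob_online_monotone_emb_HST dX n lam.
Proof.
move=> metric n1; have [P1 P2 P3 P4 P5] := linear_coverP R.
apply: (@embedding_exists R X dX x0 n 0 (@linear_cover R) 1 4 0) => //.
by move=> x m delta y z m1 mn; lia.
by rewrite ltnNge n1.
Qed.

(** With rate [4 * L] and [L = ln n] the truncation error is [1 / (n - 1)], so [n * eps <= 2] and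
    [beta = 4 * L * 3]. As [M = 8 * n], the choice [N = n ^ 6] turns the tail term into the constant
    1280, and 2400 is [10 * 12 * 20]. *)
Lemma metric_embedding (R : realType) (X : choiceType) (dX : X -> X -> R)
    (x0 : X) (n : nat) : is_metric dX -> (1 < n)%N ->
  prob_online_monotone_emb_HST dX n
    ((2400 / ln 2 + 1280 / (ln 2) ^+ 2) * (ln n%:R) ^+ 2).
Proof.
move=> metric n1; set L : R := ln n%:R.
have [d0 [deq0 [dsym dtri]]] := metric.
have n0 : 0 < n%:R :> R by rewrite ltr0n ltnW.
have n2 : 2 <= n%:R :> R by rewrite ler_nat.
have L0 : 0 < L by rewrite ln_gt0 // ltr1n.
have l20 := ln2_gt0 R.
have lL : ln 2 <= L by rewrite ler_ln ?posrE.
have Ln : L <= n%:R by apply: ln_le_nat; apply: ltnW.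
have [P1 P2 P3 P4 P5] := exp_coverP L0.
move: P5; set eps := expR _ / _ => P5.
have epsE : eps = (n%:R - 1)^-1.
  rewrite /eps /L expRN lnK ?posrE //.
  by field; rewrite subr_eq0 !gt_eqF //; lra.
have eps0 : 0 <= eps by rewrite epsE invr_ge0; lra.
have eps1 : eps <= 1 by rewrite epsE invf_le1; lra.
have neps : n%:R * eps <= 2 by rewrite epsE ler_pdivrMr; lra.
have lip s t : s <= t -> exp_cover L s - exp_cover L t <= 8 * n%:R * (t - s).
  move=> st; apply: le_trans (P5 _ _ st) _.
  have /andP[h0 h1] := P1 s; have ts : 0 <= t - s by rewrite subr_ge0.
  apply: le_trans (_ : 4 * L * (t - s) * 2 <= _).
    by apply: ler_wpM2l; [rewrite !mulr_ge0 // ltW | lra].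
  by rewrite mulrAC; apply: ler_wpM2r => //; lra.
have N1 : 1 <= n%:R ^+ 6 :> R by rewrite exprn_ege1 //; lra.
apply: (@embedding_exists R X dX x0 n (6 * up_log 2 n) (exp_cover L) (n%:R ^+ 6)
    (8 * n%:R) (12 * L)) => //.
- by rewrite mulr_ge0.
- exact: pow6_le.
- by rewrite mulr_ge0 // ltW.
- move=> x m delta y z m1 mn delta0 ym zm.
  apply: le_trans (cut_bound_exp P1 _ _ _ m y z _ eps0 delta0 P5) _ => //.
  + by move=> k; apply/deq0.
  + by rewrite mulr_ge0 // ltW.
  apply: ler_wpM2r; first by rewrite divr_ge0 // ltW.
  have : m%:R * eps <= 2.
    by apply: le_trans neps; apply: ler_wpM2r; rewrite ?ler_nat.
  by nra.
move=> _; have lev := level_count R n1; rewrite -/L in lev.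
have -> : 20 * (8 * n%:R) ^+ 2 * n%:R ^+ 4 / n%:R ^+ 6 = 1280 :> R.
  by field; rewrite gt_eqF.
have ratio : 1 <= L / ln 2 by rewrite ler_pdivlMr // mul1r.
rewrite [leRHS]mulrDl; apply: lerD.
  apply: le_trans (_ : 10 * (12 * L) * (20 * L / ln 2) <= _).
    by apply: ler_wpM2l => //; rewrite !mulr_ge0 // ltW.
  by rewrite le_eqVlt; apply/orP; left; apply/eqP; field; rewrite gt_eqF.
have -> : 1280 / ln 2 ^+ 2 * L ^+ 2 = 1280 * (L / ln 2) ^+ 2.
  by field; rewrite gt_eqF.
by rewrite ler_pMr // exprn_ege1.
Qed.

(** For uniform radii [M = 4], and packing gives [beta = 8 * K] without a logarithm, so the only one
    left counts scales. The constant 1600 is [10 * 8 * 20]. *)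
Lemma norm_embedding (R : realType) (D : nat) (Nm : 'rV[R]_D -> R) (n : nat) :
  is_norm Nm -> (1 < n)%N ->
  prob_online_monotone_emb_HST (fun x y : 'rV[R]_D => Nm (x - y)) n
    ((1600 * ((4 * D).+1 ^ D)%:R + 320) / ln 2 * ln n%:R).
Proof.
move=> normN n1; set K := ((4 * D).+1 ^ D)%N; set L : R := ln n%:R.
have metric := norm_metric normN; have [d0 [deq0 [dsym dtri]]] := metric.
have n0 : 0 < n%:R :> R by rewrite ltr0n ltnW.
have n2 : 2 <= n%:R :> R by rewrite ler_nat.
have L0 : 0 < L by rewrite ln_gt0 // ltr1n.
have l20 := ln2_gt0 R.
have lL : ln 2 <= L by rewrite ler_ln ?posrE.
have [P1 P2 P3 P4 P5] := linear_coverP R.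
have N1 : 1 <= n%:R ^+ 6 :> R by rewrite exprn_ege1 //; lra.
apply: (@embedding_exists R 'rV[R]_D _ 0 n (6 * up_log 2 n) (@linear_cover R)
    (n%:R ^+ 6) 4 (4 * (2 * K%:R))) => //.
- exact: pow6_le.
- by rewrite !mulr_ge0.
- move=> x m delta y z m1 mn delta0 ym zm.
  apply: (cut_bound_packing P1 P2) => //.
  + by move=> k; apply/deq0.
  + by move=> i _; apply: net_packing.
move=> _; have lev := level_count R n1; rewrite -/L in lev.
have ratio : 1 <= L / ln 2 by rewrite ler_pdivlMr // mul1r.
have -> : (1600 * K%:R + 320) / ln 2 * L = 1600 * K%:R * (L / ln 2) + 320 * (L / ln 2).
  by field; rewrite gt_eqF.
apply: lerD.
  apply: le_trans (_ : 10 * (4 * (2 * K%:R)) * (20 * L / ln 2) <= _).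
    by apply: ler_wpM2l => //; rewrite !mulr_ge0.
  by rewrite le_eqVlt; apply/orP; left; apply/eqP; field; rewrite gt_eqF.
apply: le_trans (_ : 320 <= _); last by rewrite ler_pMr.
rewrite ler_pdivrMr ?exprn_gt0 //.
have -> : 20 * 4 ^+ 2 * n%:R ^+ 4 = 320 * n%:R ^+ 4 :> R by ring.
by rewrite ler_pM2l // ler_eXn2l //; lra.
Qed.

Theorem mainTheorem1 (R : realType) :
  (exists C : R, forall (X : Type) (dX : X -> X -> R), is_metric dX ->
     forall n : nat, prob_online_monotone_emb_HST dX n (C * (ln (n%:R : R)) ^+ 2))
  /\
  (forall D : nat, exists C : R, forall N : 'rV[R]_D -> R, is_norm N ->
     forall n : nat,
       prob_online_monotone_emb_HST (fun x y : 'rV[R]_D => N (x - y)) n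
         (C * ln (n%:R : R))).
Proof.
split.
  exists (2400 / ln 2 + 1280 / (ln 2) ^+ 2) => X dX metric n.
  have [[x0]|X0] := pselect (inhabited X); last by apply: embedding_empty => x; case: X0.
  (* [{classic X}] equips the arbitrary type [X] with the equality test and choice operator that
     lists of points require. *)
  have [n1|n1] := leqP n 1; first exact: (@embedding_trivial R {classic X}).
  exact: (@metric_embedding R {classic X}).
move=> D; exists ((1600 * ((4 * D).+1 ^ D)%:R + 320) / ln 2) => N normN n.
have [n1|n1] := leqP n 1; last exact: norm_embedding.
by apply: (embedding_trivial 0) => //; apply: norm_metric.
Qed.
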